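(* Let $N$ be a lattice of rank two with dual lattice $M=\mathrm{Hom}(N,\mathbb{Z})$, and let $P\subset N_{\mathbb{Q}}:=N\otimes_{\mathbb{Z}}\mathbb{Q}$ be a Fano polygon. Let $h\in M$ be a primitive vector and let $F\subset N_{\mathbb{Q}}$ be a point or line segment satisfying $h(F)=0$ such that the mutation $Q:=\mathrm{mut}_h(P,F)$ exists. Then $\mathrm{SC}(P)=\mathrm{SC}(Q)$. In particular, singularity content is an invariant of Fano polygons under mutation.
   Context: Fano polygon. A lattice polygon in $N_{\mathbb{Q}}$ (convex, with vertices in $N$) is Fano if the origin lies in its strict interior and all its vertices are primitive lattice vectors. Mutation (Akhtar–Coates–Galkin–Kasprzyk). Let $h\in M$ be primitive and let $F$ be a lattice polytope in $N_{\mathbb{Q}}$ (vertices in $N$) with $h(F)=0$; thus $F$ is a point or a line segment. For $k\in\mathbb{Z}$ put $H_k=\{x\in N_{\mathbb{Q}}: h(x)=k\}$ and $w_k(P)=\mathrm{conv}(H_k\cap P\cap N)$. Let $h_{\min}<0<h_{\max}$ be the minimum and maximum of $h$ on $P$. The mutation exists if for every integer $k$ with $h_{\min}\leq k<0$ there is a (possibly empty) lattice polytope $G_k\subset N_{\mathbb{Q}}$ such that $H_k\cap\mathrm{vert}(P)\subseteq G_k+|k|F\subseteq w_k(P)$ (with Minkowski sum, and $\varnothing+|k|F=\varnothing$). In that case $$\mathrm{mut}_h(P,F):=\mathrm{conv}\left(\bigcup_{k=h_{\min}}^{-1}G_k\ \cup\ \bigcup_{k=0}^{h_{\max}}\left(w_k(P)+kF\right)\right),$$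 which is independent of the choice of the $G_k$ and is again a Fano polygon. Singularity content. For a two-dimensional cone $C\subset N_{\mathbb{Q}}$ with primitive ray generators $u,v$, the width $w$ is the lattice length of $v-u$ and the local index $\ell$ is the lattice height of the segment $uv$ above the origin. If $C$ has singularity type $\frac1r(1,a-1)$ (i.e. the affine toric surface $X_C$ is $\mathbb{A}^2/\mu_r$ with weights $1,a-1$, $\gcd(r,a-1)=1$; smooth cones have $r=1$), then $w=\gcd(r,a)$ and $\ell=r/\gcd(r,a)$. Write $w=n_C\ell+\rho$ with $n_C,\rho$ integers, $0\leq\rho<\ell$. The residue is $\mathrm{res}(C):=\frac{1}{\rho\ell}\left(1,\frac{\rho a}{w}-1\right)$ (as a singularity type, up to isomorphism of the cyclic quotient singularity) if $\rho\neq0$, and $\mathrm{res}(C):=\varnothing$ if $\rho=0$. For a Fano polygon $P$, let $C_1,\ldots,C_m$ be the cones over the facets (edges) of $P$, numbered cyclically around the origin; these are the two-dimensional cones of the spanning fan of $P$. The singularity content is $\mathrm{SC}(P):=(n,\mathcal{B})$, where $n:=\sum_{i=1}^m n_{C_i}$ and $\mathcal{B}$ is the cyclically ordered list $\{\mathrm{res}(C_1),\ldots,\mathrm{res}(C_m)\}$ with the empty residues omitted (lists considered up to cyclic rotation). *)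

(* Defs.v *)
From mathcomp Require Import all_boot all_order all_algebra.
From mathcomp Require Import all_classical.
From Stdlib Require Import Relation_Operators.

Set Implicit Arguments.
Unset Strict Implicit.
Unset Printing Implicit Defensive.

Import Order.TTheory GRing.Theory Num.Theory.

Local Open Scope classical_set_scope.
Local Open Scope ring_scope.

(* A lattice N of rank two is given inside N_Q = V, a rational vector space,  *)
(* as the Z-span of a basis e = (e_0, e_1) of V. The basis also fixes the     *)
(* orientation of N_Q. Subsets of N_Q are classical sets.                     *)

Section Convexity.
Variable V : lmodType rat.
Implicit Types (A B : set V) (v : V).

Definition conv A : set V :=
  [set x | exists (n : nat) (p : 'I_n -> V) (t : 'I_n -> rat),
     [/\ forall i, A (p i), forall i, 0 <= t i, \sum_i t i = 1
       & x = \sum_i t i *: p i]].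

Definition vert A : set V :=
  [set v | A v /\ forall x y (t : rat), A x -> A y -> 0 < t < 1 ->
     v = t *: x + (1 - t) *: y -> x = v /\ y = v].

Definition minkowski A B : set V := [set a + b | a in A & b in B].

Definition dilate (c : rat) A : set V := [set c *: a | a in A].

(* Used both for L = N in N_Q and for L = M in the dual space. Since          *)
(* 0 = 0 * 0, the zero vector is not primitive.                               *)
Definition primitive (L : set V) v : Prop :=
  L v /\ forall (d : nat) w, L w -> v = d%:R *: w -> d = 1%N.

End Convexity.

Section LatticePlane.
Variables (V : vectType rat) (e : 2.-tuple V).
Implicit Types (P Q F A : set V) (h m : 'Hom(V, rat^o)) (u v x : V).

Definition lattice : set V := [set x | forall i, coord e i x \is a Num.int].

(* M = Hom(N, Z), embedded in the dual space of N_Q. *)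
Definition dual_lattice : set 'Hom(V, rat^o) :=
  [set m | forall x, lattice x -> (m x : rat) \is a Num.int].

Definition det u v : rat :=
  coord e 0 u * coord e 1 v - coord e 0 v * coord e 1 u.

(* The empty set is allowed. *)
Definition lattice_polytope A : Prop :=
  exists2 s : seq V, (forall x, x \in s -> lattice x) & A = conv [set` s].

Definition strict_interior A : set V :=
  [set x | exists2 d : rat, 0 < d &
     forall y, (forall i, `|coord e i (y - x)| < d) -> A y].

Definition fano_polygon P : Prop :=
  [/\ lattice_polytope P, strict_interior P 0
    & forall v, vert P v -> primitive lattice v].

Definition level h (k : int) : set V := [set x | (h x : rat) = k%:~R].

Definition slice h P (k : int) : set V := conv (level h k `&` P `&` lattice).

Definition is_min h P (k : int) : Prop :=
  (exists2 x, P x & level h k x) /\ forall x, P x -> k%:~R <= (h x : rat).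

Definition is_max h P (k : int) : Prop :=
  (exists2 x, P x & level h k x) /\ forall x, P x -> (h x : rat) <= k%:~R.

Definition admissible h P F (hmin : int) (G : int -> set V) : Prop :=
  forall k : int, hmin <= k < 0 ->
    [/\ lattice_polytope (G k),
        level h k `&` vert P `<=` minkowski (G k) (dilate `|k|%:~R F)
      & minkowski (G k) (dilate `|k|%:~R F) `<=` slice h P k].

Definition mutation_with h P F (hmin hmax : int) (G : int -> set V) : set V :=
  conv (\bigcup_(k in [set k : int | hmin <= k < 0]) G k `|`
        \bigcup_(k in [set k : int | 0 <= k <= hmax])
          minkowski (slice h P k) (dilate k%:~R F)).

(* The mutation mut_h(P, F) exists and is equal to Q. The set Q does not      *)
(* depend on the choice of the factors G k.                                   *)
Definition is_mutation h P F Q : Prop :=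
  exists hmin hmax : int, [/\ is_min h P hmin, is_max h P hmax
    & exists2 G, admissible h P F hmin G & Q = mutation_with h P F hmin hmax G].

(* The factor F is a nonempty lattice polytope in the line h = 0, hence a     *)
(* point or a line segment.                                                   *)
Definition is_factor h F : Prop :=
  [/\ lattice_polytope F, F !=set0 & F `<=` level h 0].

Definition mutates P Q : Prop :=
  fano_polygon P /\ exists h F,
    [/\ primitive dual_lattice h, is_factor h F & is_mutation h P F Q].

Definition mutation_equivalent : set V -> set V -> Prop :=
  clos_refl_sym_trans (set V) mutates.

(* Below, (u, v) are the primitive ray generators of a two-dimensional cone.  *)

Definition width u v : nat :=
  get [set w : nat | exists2 f, primitive lattice f & v - u = w%:R *: f].

Definition local_index u v : nat :=
  get [set l : nat | exists2 m, primitive dual_lattice m &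
                       (m u : rat) = l%:R /\ (m v : rat) = l%:R].

(* The toric variety of cone(u, v) is the quotient of A^2 by mu_r with        *)
(* weights (1, a - 1) when N = Zu + Zv + Z (1/r)(u + (a - 1)v).               *)
Definition has_singularity_type u v (r : nat) (a : int) : Prop :=
  [/\ (0 < r)%N, coprimez r%:Z (a - 1)
    & forall x, lattice x <-> exists i j k : int,
        x = i%:~R *: u + j%:~R *: v
            + k%:~R *: (r%:R^-1 *: (u + (a - 1)%:~R *: v))].

(* The isomorphism class of 1/r(1, b), as the set of all pairs (r', b') with  *)
(* 1/r'(1, b') isomorphic to it; exchanging the two coordinates of A^2        *)
(* replaces b by its inverse modulo r.                                        *)
Definition singularity_class (r : nat) (b : int) : set (nat * int) :=
  [set p | p.1 = r /\
     ((p.2 = b %[mod r%:Z])%Z \/ (p.2 * b = 1 %[mod r%:Z])%Z)].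

Definition nT u v : nat := (width u v %/ local_index u v)%N.

Definition rho u v : nat := (width u v %% local_index u v)%N.

(* The class below does not depend on the presentation 1/r(1, a - 1) of the   *)
(* cone, so the set of (r', b') ranging over all presentations is that class. *)
Definition residue u v : option (set (nat * int)) :=
  if rho u v == 0%N then None else
  Some [set p | exists r a, has_singularity_type u v r a /\
    singularity_class (rho u v * local_index u v)%N
      (((rho u v)%:Z * a %/ (width u v)%:Z)%Z - 1) p].

(* The segment uv is an edge of P, oriented counterclockwise about 0. *)
Definition ccw_edge P u v : Prop :=
  0 < det u v /\
  exists m (c : rat), (forall x, P x -> (m x : rat) <= c) /\
    P `&` [set x | (m x : rat) = c] = conv [set u; v].

(* The vertices of P listed in cyclic order; the facets of P are then the     *)
(* segments from v to next s v.                                               *)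
Definition boundary_cycle P (s : seq V) : Prop :=
  [/\ uniq s, [set` s] = vert P
    & forall v, v \in s -> ccw_edge P v (next s v)].

(* SC(P) = (n, B), where B is a list up to rotation: the pair is encoded as   *)
(* the set of all (n, B') with B' in the rotation class of B.                 *)
Definition singularity_content P : set (nat * seq (set (nat * int))) :=
  [set c | exists s k, boundary_cycle P s /\
     c = (\sum_(v <- s) nT v (next s v),
          rot k (pmap (fun v => residue v (next s v)) s))%N].

End LatticePlane.

(* Main.v *)
Require Import Defs.
From HB Require Import structures.
From mathcomp Require Import all_boot all_order all_algebra.
From mathcomp Require Import all_classical.
From mathcomp Require Import ring lra zify.

Set Implicit Arguments.
Unset Strict Implicit.
Unset Printing Implicit Defensive.

Import Order.TTheory GRing.Theory Num.Theory.

Local Open Scope classical_set_scope.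
Local Open Scope ring_scope.

(** Choose lattice coordinates in which the mutation vector h is the height and
    the factor is the horizontal segment F = [p f, q f] with p <= q. The boundary
    of P consists of a right chain, which goes up, a left chain, which goes down,
    and at most two horizontal edges, at the heights hmax and hmin.

    A mutation shears the right chain by x |-> x + q h(x) f and the left chain by
    x |-> x + p h(x) f ([mutation_mem], [mutation_sub], [mutation_chains]). Both
    maps are automorphisms of the lattice, so the cones over the edges of the two
    chains keep their types ([residue_auto], [nT_auto]). What remains are the
    horizontal edges. The cone over a horizontal edge of width w at height k has
    local index |k|, and its residue depends only on w modulo k once one end of
    the edge is fixed ([residue_horizontal]). The two shears lengthen the top edge
    by hmax (q - p) and shorten the bottom edge by |hmin| (q - p). Hence both
    residues are preserved, while n gains q - p at the top and loses q - p at the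
    bottom ([horizontal_step]).

    A horizontal edge may degenerate to a vertex in P or in its mutation. Such a
    vertex is counted as an edge of width zero, with n = 0 and empty residue. The
    singularity content is therefore computed along a closed walk that joins the
    two chains by two possibly trivial steps ([singularity_content_chains]), and
    the walks of P and of its mutation correspond step by step.

    To reach this description, the right chain of a polygon is obtained by sorting
    its rightmost vertices by height ([right_chain_exists]). The two chains form
    the boundary cycle ([boundary_walk_cycle]), and this cycle is unique up to
    rotation ([boundary_cycle_rot]). Everything about the left chain and the bottom
    edge follows from the right chain and the top edge by a half-turn of the
    coordinates ([opp_frame]). *)

(** * Convex sets and their vertices *)

Section ConvexSets.
Variable V : lmodType rat.
Implicit Types (A B : set V) (u v x y : V) (s : seq V) (m : V -> rat).

Definition convex B : Prop :=
  forall x y (t : rat), B x -> B y -> 0 <= t <= 1 -> B (t *: x + (1 - t) *: y).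

Definition affine m : Prop :=
  forall x y (t : rat), m (t *: x + (1 - t) *: y) = t * m x + (1 - t) * m y.

Lemma sub_conv A : A `<=` conv A.
Proof.
move=> x Ax; exists 1%N, (fun=> x), (fun=> 1).
by split=> //; rewrite ?big_ord1 ?scale1r.
Qed.

Lemma conv_convex A : convex (conv A).
Proof.
move=> x y t [n [p [a [Ap a0 a1 ->]]]] [n' [p' [a' [Ap' a0' a1' ->]]]] /andP[t0 t1].
exists (n + n')%N,
  (fun i => match fintype.split i with inl j => p j | inr j => p' j end),
  (fun i => match fintype.split i with inl j => t * a j | inr j => (1 - t) * a' j end).
have lK (j : 'I_n) : fintype.split (lshift n' j) = inl j.
  by rewrite -[lshift _ _]/(unsplit (inl j)) unsplitK.
have rK (j : 'I_n') : fintype.split (rshift n j) = inr j.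
  by rewrite -[rshift _ _]/(unsplit (inr j)) unsplitK.
split.
- by move=> i; case: (fintype.split i).
- by move=> i; case: (fintype.split i) => j; rewrite mulr_ge0 // subr_ge0.
- rewrite big_split_ord /=.
  under eq_bigr do rewrite lK; under [X in _ + X]eq_bigr do rewrite rK.
  by rewrite -!mulr_sumr a1 a1' !mulr1 addrC subrK.
- rewrite big_split_ord /= !scaler_sumr; congr (_ + _); apply: eq_bigr => j _.
    by rewrite lK scalerA.
  by rewrite rK scalerA.
Qed.

(** The defining property of the hull with respect to binary convexity: a convex
    combination of n points is one of its first point and of a combination of
    the others, once the weights of the latter are renormalized. *)
Lemma conv_min A B : convex B -> A `<=` B -> conv A `<=` B.
Proof.
move=> cB AB x [n [p [t [Ap]]]]; elim: n p t x Ap => [|n IHn] p t x Ap t0.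
  by rewrite big_ord0 => /eqP; rewrite eq_sym oner_eq0.
rewrite !big_ord_recl => t1 ->.
have [t01|t0N1] := eqVneq (t ord0) 1.
  have t0' i : t (lift ord0 i) = 0.
    have S0 : \sum_(i < n) t (lift ord0 i) = 0 by move: t1; rewrite t01; lra.
    by have /psumr_eq0P := S0; apply.
  rewrite big1 ?addr0; last by move=> i _; rewrite t0' scale0r.
  by rewrite t01 scale1r; exact: AB.
have St : \sum_(i < n) t (lift ord0 i) = 1 - t ord0 by rewrite -t1 addrC addKr.
have lt1 : t ord0 < 1.
  rewrite lt_neqAle t0N1 -subr_ge0 -St; exact: sumr_ge0.
have n0 : 1 - t ord0 != 0 by lra.
set y := \sum_(i < n) _.
have -> : y = (1 - t ord0) *: \sum_(i < n) ((1 - t ord0)^-1 * t (lift ord0 i)) *: p (lift ord0 i).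
  by rewrite scaler_sumr; apply: eq_bigr => i _; rewrite scalerA mulrA mulfV // mul1r.
apply: cB; [exact: AB| |by rewrite t0 ltW].
apply: (IHn (fun i => p (lift ord0 i)) (fun i => (1 - t ord0)^-1 * t (lift ord0 i))) => //.
  by move=> i; rewrite mulr_ge0 // invr_ge0 subr_ge0 ltW.
by rewrite -mulr_sumr St mulVf.
Qed.

Lemma convex_conv2 B u v : convex B -> B u -> B v -> conv [set u; v] `<=` B.
Proof. by move=> cB Bu Bv; apply: conv_min => // x [->|->]. Qed.

Lemma conv2P u v x :
  conv [set u; v] x <-> exists2 t : rat, 0 <= t <= 1 & x = t *: u + (1 - t) *: v.
Proof.
split=> [|[t t01 ->]]; last first.
  by apply: conv_convex => //; apply: sub_conv; [left|right].
apply: (@conv_min [set u; v]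
  [set x | exists2 t : rat, 0 <= t <= 1 & x = t *: u + (1 - t) *: v]); last first.
  move=> _ [->|->].
    by exists 1 => //; rewrite subrr scale0r scale1r addr0.
  by exists 0 => //; rewrite subr0 scale0r scale1r add0r.
move=> _ _ t [a a01 ->] [b b01 ->] t01; exists (t * a + (1 - t) * b); first by nra.
rewrite !scalerDr !scalerA addrACA -!scalerDl; congr (_ + _ *: _); ring.
Qed.

Lemma conv_set0 : conv set0 = set0 :> set V.
Proof. by rewrite -subset0; apply: conv_min. Qed.

(** Removing a vertex from a convex set leaves a convex set, so a vertex that did
    not belong to A could be removed from the hull of A. *)
Lemma conv_vert A : vert (conv A) `<=` A.
Proof.
move=> v [cv ev]; apply: contrapT => nAv.
suff: conv A `<=` [set x | conv A x /\ x <> v] by move/(_ v cv) => [].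
apply: conv_min => [x y t [cx xv] [cy yv] t01 /=|x Ax].
  split; first exact: conv_convex.
  move=> E; have [t0|tN0] := eqVneq t 0.
    by move: E; rewrite t0 subr0 scale0r scale1r add0r.
  have [t1|tN1] := eqVneq t 1.
    by move: E; rewrite t1 subrr scale0r scale1r addr0.
  by have [|//] := ev x y t cx cy _ (esym E); lra.
by split; [exact: sub_conv|move=> xv; apply: nAv; rewrite -xv].
Qed.

Definition lexle m m' x y := m x < m y \/ m x = m y /\ m' x <= m' y.

Lemma lex_argmax m m' s : s != [::] ->
  exists2 v, v \in s & forall x, x \in s -> lexle m m' x v.
Proof.
elim: s => // a [|b s] IHs _.
  by exists a; rewrite ?inE // => x; rewrite inE => /eqP->; right.
have [//|v vs vmax] := IHs.
have [av|nav] := pselect (lexle m m' a v).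
  exists v; first by rewrite inE vs orbT.
  by move=> x; rewrite inE => /predU1P[->//|/vmax].
have va : lexle m m' v a.
  rewrite /lexle in nav *; have [H|H|H] := ltgtP (m v) (m a); [by left| |].
    by case: nav; left.
  right; split=> //; rewrite leNgt; apply/negP => H'; apply: nav; right.
  by split=> //; exact: ltW.
exists a; first by rewrite inE eqxx.
move=> x; rewrite inE => /predU1P[->|/vmax xv]; first by right.
move: xv va; rewrite /lexle => -[xv|[xv xv']] [va|[va va']].
- left; lra.
- left; lra.
- left; lra.
- right; lra.
Qed.

(** Linear programming with tie-breaking: among the points that maximize m, one
    maximizes m', and it is a vertex because the pair (m, m') separates points. *)
Lemma lex_vertex m m' s : affine m -> affine m' ->
    (forall x y, m x = m y -> m' x = m' y -> x = y) -> s != [::] ->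
  exists2 v, vert (conv [set` s]) v
    & forall x, conv [set` s] x -> lexle m m' x v.
Proof.
move=> am am' inj s0; have [v vs vmax] := lex_argmax m m' s0.
have cmax x : conv [set` s] x -> lexle m m' x v.
  apply: (@conv_min _ [set x | lexle m m' x v]) => // {}x y t /= xv yv t01.
  rewrite /lexle am am'; move: xv yv => [xv|[xv xv']] [yv|[yv yv']].
  - have [->|t0] := eqVneq t 0; first by left; lra.
    left; have : 0 < t by lra.
    by nra.
  - have [->|t0] := eqVneq t 0; first by right; lra.
    left; have : 0 < t by lra.
    by nra.
  - have [->|t0] := eqVneq t 1; first by right; lra.
    left; have : 0 < 1 - t by lra.
    by nra.
  - right; nra.
exists v => //; split; first exact: sub_conv.
move=> x y t /cmax xv /cmax yv t01 E.
have Em : m v = t * m x + (1 - t) * m y by rewrite {1}E am.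
have Em' : m' v = t * m' x + (1 - t) * m' y by rewrite {1}E am'.
have [mxv myv] : m x <= m v /\ m y <= m v.
  by split; [case: xv => [/ltW//|[->]//]|case: yv => [/ltW//|[->]//]].
have [mxE myE] : m x = m v /\ m y = m v by split; nra.
case: xv => [|[_ xv]]; first by rewrite mxE ltxx.
case: yv => [|[_ yv]]; first by rewrite myE ltxx.
by split; apply: inj => //; nra.
Qed.

End ConvexSets.

(** * Coordinates adapted to the height function *)

Section Frames.
Variables (V : vectType rat) (e : 2.-tuple V).

(** An oriented lattice basis (axis, coaxis) with its dual basis (abscissa,
    height). The height plays the part of the primitive vector h of the mutation,
    and the axis spans the line that contains the factor. *)
Record frame := Frame {
  axis : V;
  coaxis : V;
  abscissa : 'Hom(V, rat^o);
  height : 'Hom(V, rat^o);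
  frame_decomposition x :
    x = (abscissa x : rat) *: axis + (height x : rat) *: coaxis;
  abscissa_axis : abscissa axis = 1;
  height_axis : height axis = 0;
  abscissa_coaxis : abscissa coaxis = 0;
  height_coaxis : height coaxis = 1;
  lattice_frame x : lattice e x <->
    (abscissa x : rat) \is a Num.int /\ (height x : rat) \is a Num.int;
  det_frame u v : det e u v = (abscissa u : rat) * height v - (abscissa v : rat) * height u
}.

Variable fr : frame.
Definition cx (x : V) : rat := abscissa fr x.
Definition cy (x : V) : rat := height fr x.
Local Notation f := (axis fr).

Lemma cxD x y : cx (x + y) = cx x + cx y. Proof. by rewrite /cx linearD. Qed.
Lemma cyD x y : cy (x + y) = cy x + cy y. Proof. by rewrite /cy linearD. Qed.
Lemma cxZ a x : cx (a *: x) = a * cx x. Proof. by rewrite /cx linearZ. Qed.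
Lemma cyZ a x : cy (a *: x) = a * cy x. Proof. by rewrite /cy linearZ. Qed.
Lemma cxN x : cx (- x) = - cx x. Proof. by rewrite /cx linearN. Qed.
Lemma cyN x : cy (- x) = - cy x. Proof. by rewrite /cy linearN. Qed.
Lemma cx0 : cx 0 = 0. Proof. by rewrite /cx linear0. Qed.
Lemma cy0 : cy 0 = 0. Proof. by rewrite /cy linear0. Qed.
Lemma cxf : cx f = 1. Proof. exact: abscissa_axis. Qed.
Lemma cyf : cy f = 0. Proof. exact: height_axis. Qed.

Definition coordE := (cxD, cyD, cxZ, cyZ, cxN, cyN, cx0, cy0, cxf, cyf).

Lemma coord_inj x y : cx x = cx y -> cy x = cy y -> x = y.
Proof.
move=> Ex Ey; rewrite (frame_decomposition fr x) (frame_decomposition fr y).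
by rewrite -/(cx x) -/(cx y) -/(cy x) -/(cy y) Ex Ey.
Qed.

Lemma functionalE (m : 'Hom(V, rat^o)) x :
  (m x : rat) = cx x * m f + cy x * m (coaxis fr).
Proof. by rewrite {1}(frame_decomposition fr x) linearD !linearZ. Qed.

Lemma functional_of (a b : rat) :
  exists m : 'Hom(V, rat^o), forall x, (m x : rat) = a * cx x + b * cy x.
Proof.
exists (a *: abscissa fr + b *: height fr) => x.
by rewrite add_lfunE !scale_lfunE.
Qed.

End Frames.

Arguments coordE {V e fr}.
Arguments coord_inj {V e} fr [x y].

Section FrameConstructions.
Variables (V : vectType rat) (e : 2.-tuple V).

(** The half-turn of the coordinates. It exchanges left with right and top with
    bottom but preserves the orientation, so every statement about the right
    boundary or the top edge of a polygon also yields the one about the left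
    boundary or the bottom edge. *)
Definition opp_frame (fr : frame e) : frame e.
Proof.
refine (@Frame V e (- axis fr) (- coaxis fr) (- abscissa fr) (- height fr) _ _ _ _ _ _ _).
- by move=> x; rewrite !opp_lfunE !scalerN !scaleNr !opprK; exact: frame_decomposition.
- by rewrite opp_lfunE linearN opprK; exact: abscissa_axis.
- by rewrite opp_lfunE linearN opprK; exact: height_axis.
- by rewrite opp_lfunE linearN opprK; exact: abscissa_coaxis.
- by rewrite opp_lfunE linearN opprK; exact: height_coaxis.
- by move=> x; rewrite !opp_lfunE !rpredN; exact: lattice_frame.
- move=> u v; rewrite !opp_lfunE (det_frame fr).
  by rewrite -/(cx fr u) -/(cx fr v) -/(cy fr u) -/(cy fr v); ring.
Defined.

Lemma cx_opp fr x : cx (opp_frame fr) x = - cx fr x.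
Proof. by rewrite /cx opp_lfunE. Qed.

Lemma cy_opp fr x : cy (opp_frame fr) x = - cy fr x.
Proof. by rewrite /cy opp_lfunE. Qed.

(** Primitivity makes the coordinates (a, b) of h coprime; a Bezout relation
    s a + t b = 1 then provides the coaxis (s, t), and the axis is (b, - a). *)
Lemma frame_of_height (h : 'Hom(V, rat^o)) : basis_of fullv e ->
  primitive (dual_lattice e) h -> exists fr : frame e, height fr = h.
Proof.
move=> he [hL hprim].
have fe : free e := basis_free he.
have E1 : lift ord0 ord0 = 1 :> 'I_2 by apply: val_inj.
have I2 (i : 'I_2) : i = 0 \/ i = 1.
  by case: i => [[|[|]]] // H; [left|right]; apply: val_inj.
have dec x : x = coord e 0 x *: e`_0 + coord e 1 x *: e`_1.
  by rewrite {1}(coord_basis he (memvf x)) !big_ord_recl big_ord0 addr0 E1.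
have c00 : coord e 0 e`_0 = 1 by rewrite (coord_free 0 0 fe).
have c01 : coord e 0 e`_1 = 0 by rewrite (coord_free 1 0 fe).
have c10 : coord e 1 e`_0 = 0 by rewrite (coord_free 0 1 fe).
have c11 : coord e 1 e`_1 = 1 by rewrite (coord_free 1 1 fe).
have L0 : lattice e e`_0 by move=> i; case: (I2 i) => ->; rewrite ?c00 ?c10.
have L1 : lattice e e`_1 by move=> i; case: (I2 i) => ->; rewrite ?c01 ?c11.
have /intrP[a ha] := hL _ L0; have /intrP[b hb] := hL _ L1.
have hE x : (h x : rat) = coord e 0 x * a%:~R + coord e 1 x * b%:~R.
  by rewrite {1}(dec x) linearD !linearZ /= ha hb.
have gcd1 : gcdz a b = 1.
  rewrite /gcdz; set d := gcdn _ _.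
  have [d0|dn0] := eqVneq d 0%N.
    have : (d%:Z = 0) by rewrite d0.
    rewrite -[d%:Z]/(gcdz a b) => /eqP; rewrite gcdz_eq0 => /andP[/eqP a0 /eqP b0].
    suff : 2%N = 1%N by [].
    apply: (hprim 2%N 0); first by move=> x _; rewrite zero_lfunE rpred0.
    by rewrite scaler0; apply/lfunP => x; rewrite zero_lfunE [LHS]hE a0 b0 !mulr0 addr0.
  have da : (d%:Z %| a)%Z by exact: dvdz_gcdl.
  have db : (d%:Z %| b)%Z by exact: dvdz_gcdr.
  have dR : (d%:R : rat) != 0 by rewrite pnatr_eq0.
  congr (_%:Z); apply: (hprim d (d%:R^-1 *: h)); last by rewrite scalerA mulfV // scale1r.
  move=> x xL; rewrite scale_lfunE; change ((d%:R^-1 * (h x : rat)) \is a Num.int).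
  rewrite hE.
  have -> : d%:R^-1 * (coord e 0 x * a%:~R + coord e 1 x * b%:~R)
      = coord e 0 x * (a %/ d)%Z%:~R + coord e 1 x * (b %/ d)%Z%:~R.
    rewrite -{1}(divzK da) -{1}(divzK db) !intrM.
    by field.
  by apply: rpredD; apply: rpredM; rewrite ?intr_int //; exact: xL.
have [s [t st]] := Bezoutz a b; rewrite gcd1 in st.
have st' : s%:~R * a%:~R + t%:~R * b%:~R = 1 :> rat by rewrite -!intrM -intrD st.
pose X : 'Hom(V, rat^o) :=
  t%:~R *: linfun (coord e 0 : V -> rat^o) - s%:~R *: linfun (coord e 1 : V -> rat^o).
have XE x : (X x : rat) = t%:~R * coord e 0 x - s%:~R * coord e 1 x.
  by rewrite /X add_lfunE opp_lfunE !scale_lfunE !lfunE.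
pose f := b%:~R *: e`_0 - a%:~R *: e`_1; pose g := s%:~R *: e`_0 + t%:~R *: e`_1.
have f0 : coord e 0 f = b%:~R by rewrite /f linearB !linearZ /= c00 c01 mulr1 mulr0 subr0.
have f1 : coord e 1 f = - a%:~R by rewrite /f linearB !linearZ /= c10 c11 mulr1 mulr0 sub0r.
have g0 : coord e 0 g = s%:~R by rewrite /g linearD !linearZ /= c00 c01 mulr1 mulr0 addr0.
have g1 : coord e 1 g = t%:~R by rewrite /g linearD !linearZ /= c10 c11 mulr1 mulr0 add0r.
have K0 x : coord e 0 x = (X x : rat) * b%:~R + (h x : rat) * s%:~R.
  rewrite XE hE; transitivity ((s%:~R * a%:~R + t%:~R * b%:~R) * coord e 0 x); last by ring.
  by rewrite st' mul1r.
have K1 x : coord e 1 x = - ((X x : rat) * a%:~R) + (h x : rat) * t%:~R.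
  rewrite XE hE; transitivity ((s%:~R * a%:~R + t%:~R * b%:~R) * coord e 1 x); last by ring.
  by rewrite st' mul1r.
have dfr x : x = (X x : rat) *: f + (h x : rat) *: g.
  rewrite {1}(dec x) K0 K1 /f /g; move: (X x : rat) (h x : rat) => p q.
  rewrite scalerBr !scalerDr !scalerA !scalerDl scaleNr; exact: addrACA.
have Xf : X f = 1 by rewrite XE f0 f1 -[RHS]st'; ring.
have hf : h f = 0 by rewrite [LHS]hE f0 f1; ring.
have Xg : X g = 0 by rewrite XE g0 g1; ring.
have hg : h g = 1 by rewrite [LHS]hE g0 g1.
have latE x : lattice e x <-> (X x : rat) \is a Num.int /\ (h x : rat) \is a Num.int.
  split=> [xL|[Xx hx] i].
    split; last exact: hL.
    by rewrite XE; apply: rpredB; apply: rpredM; rewrite ?intr_int //; exact: xL.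
  by case: (I2 i) => ->; rewrite ?K0 ?K1 !(rpredD, rpredN, rpredM, intr_int).
have dE u v : det e u v = (X u : rat) * h v - (X v : rat) * h u.
  rewrite /det !K0 !K1; move: (X u : rat) (h u : rat) (X v : rat) (h v : rat) => p q p' q'.
  transitivity ((p * q' - p' * q) * (s%:~R * a%:~R + t%:~R * b%:~R)); first by ring.
  by rewrite st' mulr1.
by exists (Frame dfr Xf hf Xg hg latE dE).
Qed.

End FrameConstructions.

(** * Counterclockwise edges *)

Section Edges.
Variables (V : vectType rat) (e : 2.-tuple V) (fr : frame e).
Implicit Types (P : set V) (u v x : V).
Local Notation X := (cx fr).
Local Notation Y := (cy fr).

(** The determinant of x and v - u: up to a factor, the only linear form that is
    constant on the line uv. *)
Definition side u v x : rat := X x * (Y v - Y u) - Y x * (X v - X u).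

Lemma detE u v : det e u v = X u * Y v - X v * Y u.
Proof. exact: det_frame. Qed.

Lemma side_affine u v : affine (side u v).
Proof. by move=> x y t; rewrite /side !coordE; ring. Qed.

Lemma abscissa_affine : affine X.
Proof. by move=> x y t; rewrite !coordE. Qed.

Lemma height_affine : affine Y.
Proof. by move=> x y t; rewrite !coordE. Qed.

Lemma side_height_inj u v x y : Y u != Y v ->
  side u v x = side u v y -> Y x = Y y -> x = y.
Proof.
move=> uv; rewrite /side => S E; apply: (coord_inj fr _ E).
have N : Y v - Y u != 0 by rewrite subr_eq0 eq_sym.
by apply: (mulIf N); move: S; rewrite E; lra.
Qed.

(** The supporting form of an edge may be taken to be [side]. Indeed a form m with
    m u = m v = c satisfies m * det u v = c * side, and c > 0 because the origin
    lies in P but not on the segment uv. *)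
Lemma ccw_edgeP P u v : convex P -> P 0 ->
  ccw_edge e P u v <-> [/\ 0 < det e u v, P u, P v
    & forall x, P x -> side u v x <= side u v u
        /\ (side u v x = side u v u -> conv [set u; v] x)].
Proof.
move=> cP P0; split=> [[D [m [c [mc face]]]]|[D Pu Pv S]]; last first.
  split=> //; have [m mE] := functional_of fr (Y v - Y u) (- (X v - X u)).
  have mS x : (m x : rat) = side u v x by rewrite mE /side; ring.
  exists m, (side u v u); split=> [x /S[]|]; first by rewrite mS.
  rewrite eqEsubset; split=> x.
    by move=> [/S[_ +] mx]; apply; rewrite -mS.
  move=> cx; split; first exact: convex_conv2 cx.
  have [t _ ->] := (conv2P u v x).1 cx.
  by rewrite /= mS side_affine (_ : side u v v = side u v u) /side; ring.
have [Pu mu] : P u /\ (m u : rat) = c.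
  suff : (P `&` [set x | (m x : rat) = c]) u by [].
  by rewrite face; apply: sub_conv; left.
have [Pv mv] : P v /\ (m v : rat) = c.
  suff : (P `&` [set x | (m x : rat) = c]) v by [].
  by rewrite face; apply: sub_conv; right.
have D' := D; rewrite detE in D'.
have mD x : (m x : rat) * det e u v = c * side u v x.
  have [a [b mE]] : exists a b : rat, forall y, (m y : rat) = X y * a + Y y * b.
    by exists (m (axis fr)), (m (coaxis fr)) => y; exact: functionalE.
  move: mu mv; rewrite !mE detE /side => E1 E2.
  transitivity (X x * ((X u * a + Y u * b) * Y v - (X v * a + Y v * b) * Y u)
    + Y x * ((X v * a + Y v * b) * X u - (X u * a + Y u * b) * X v)); first by ring.
  by rewrite E1 E2; ring.
have c0 : 0 < c.
  rewrite lt_neqAle; apply/andP; split; last first.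
    by have := mc _ P0; rewrite linear0.
  apply/negP => /eqP c0.
  have : (P `&` [set x | (m x : rat) = c]) 0 by split=> //=; rewrite linear0.
  rewrite face => /conv2P[t t01 E].
  have EX : 0 = t * X u + (1 - t) * X v by rewrite -abscissa_affine -E coordE.
  have EY : 0 = t * Y u + (1 - t) * Y v by rewrite -height_affine -E coordE.
  have Z1 : t * (X u * Y v - X v * Y u) = 0.
    transitivity ((t * X u + (1 - t) * X v) * Y v - (t * Y u + (1 - t) * Y v) * X v); first by ring.
    by rewrite -EX -EY !mul0r subrr.
  have Z2 : (1 - t) * (X u * Y v - X v * Y u) = 0.
    transitivity (X u * (t * Y u + (1 - t) * Y v) - Y u * (t * X u + (1 - t) * X v)); first by ring.
    by rewrite -EX -EY !mulr0 subrr.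
  by nra.
have su : c * side u v u = c * det e u v by rewrite -mD mu.
split=> // x Px; split.
  by rewrite -(ler_pM2l c0) su -mD ler_pM2r //; exact: mc.
move=> sx; rewrite -face; split=> //=.
by apply: (mulIf (lt0r_neq0 D)); rewrite mD sx su.
Qed.

Lemma ccw_edge_vert P u v : convex P -> P 0 -> ccw_edge e P u v -> vert P u.
Proof.
move=> cP P0 /(ccw_edgeP u v cP P0)[D Pu Pv S]; split=> // x y t Px Py t01 E.
have [Sx cx] := S x Px; have [Sy cy] := S y Py.
have : side u v u = t * side u v x + (1 - t) * side u v y by rewrite -side_affine -E.
move=> Es; have {}/cx/conv2P[a a01 xE] : side u v x = side u v u by nra.
have {}/cy/conv2P[b b01 yE] : side u v y = side u v u by nra.
rewrite detE in D.
suff [a1 b1] : a = 1 /\ b = 1.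
  by rewrite xE yE a1 b1 subrr scale0r scale1r addr0.
have EX : X u = t * (a * X u + (1 - a) * X v) + (1 - t) * (b * X u + (1 - b) * X v).
  by rewrite -!abscissa_affine -xE -yE -E.
have EY : Y u = t * (a * Y u + (1 - a) * Y v) + (1 - t) * (b * Y u + (1 - b) * Y v).
  by rewrite -!height_affine -xE -yE -E.
have Z : (t * (1 - a) + (1 - t) * (1 - b)) * (X u * Y v - X v * Y u) = 0.
  set k := t * a + (1 - t) * b.
  have EX' : (1 - k) * X u = (1 - k) * X v by rewrite /k; lra.
  have EY' : (1 - k) * Y u = (1 - k) * Y v by rewrite /k; lra.
  transitivity (((1 - k) * X u) * Y v - X v * ((1 - k) * Y u)); first by rewrite /k; ring.
  by rewrite EX' EY'; ring.
have {}Z : t * (1 - a) + (1 - t) * (1 - b) = 0 by nra.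
by split; nra.
Qed.

(** Each of v, v' lies on the inner side of the edge to the other one, so u, v, v'
    are collinear and v, v' each lie on the segment from u to the other. *)
Lemma ccw_edge_unique P u v v' : convex P -> P 0 ->
  ccw_edge e P u v -> ccw_edge e P u v' -> v = v'.
Proof.
move=> cP P0 /(ccw_edgeP u v cP P0)[D Pu Pv S] /(ccw_edgeP u v' cP P0)[D' _ Pv' S'].
have [s1 c1] := S v' Pv'; have [s2 c2] := S' v Pv.
have opp : side u v v' - side u v u = - (side u v' v - side u v' u).
  by rewrite /side; ring.
have {}/c1/conv2P[t t01 E1] : side u v v' = side u v u by lra.
have {}/c2/conv2P[t' t01' E2] : side u v' v = side u v' u by lra.
rewrite !detE in D D'.
have k1 : X u * Y v' - X v' * Y u = (1 - t) * (X u * Y v - X v * Y u).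
  by rewrite E1 !coordE; ring.
have k2 : X u * Y v - X v * Y u = (1 - t') * (X u * Y v' - X v' * Y u).
  by rewrite [in LHS]E2 !coordE; ring.
have t0 : t = 0 by nra.
by rewrite E1 t0 scale0r add0r subr0 scale1r.
Qed.

End Edges.

(** * The right boundary chain of a polygon *)

Section RightChains.
Variables (V : vectType rat) (e : 2.-tuple V).
Implicit Types (P : set V) (u v x r : V) (s R : seq V).

Definition rightmost (f : V) P r := P r /\ forall t : rat, P (r + t *: f) -> t <= 0.

Definition right_step (fr : frame e) P u v : bool :=
  (cy fr u < cy fr v) && `[< ccw_edge e P u v >].

(** The right half [r :: R] of the boundary, listed from bottom to top, where kmin
    and kmax are the extreme heights of the polygon. *)
Record right_chain (fr : frame e) P (kmin kmax : rat) r R : Prop := RightChain {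
  chain_path : path (right_step fr P) r R;
  chain_bottom : cy fr r = kmin;
  chain_top : cy fr (last r R) = kmax;
  chain_rightmost x : x \in r :: R -> rightmost (axis fr) P x
}.

Variable fr : frame e.
Local Notation X := (cx fr).
Local Notation Y := (cy fr).
Local Notation f := (axis fr).

Lemma rightmost_abscissa P r x :
  rightmost f P r -> P x -> Y x = Y r -> X x <= X r.
Proof.
move=> [_ rm] Px E; rewrite -subr_le0; apply: rm.
suff -> : r + (X x - X r) *: f = x by [].
by apply: (coord_inj fr); rewrite !coordE; lra.
Qed.

Lemma rightmost_inj P u v : rightmost f P u -> rightmost f P v -> Y u = Y v -> u = v.
Proof.
move=> ru rv E; apply: (coord_inj fr _ E).
apply: le_anti; rewrite (rightmost_abscissa rv) ?(rightmost_abscissa ru) //.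
  by case: rv.
by case: ru.
Qed.

Section Existence.
Variables (P : set V) (s : seq V).
Hypothesis Ps : P = conv [set` s].
Let cP : convex P. Proof. rewrite Ps; exact: conv_convex. Qed.

Let corner v := vert P v /\ rightmost f P v.

Let corner_mem v : corner v -> v \in s.
Proof. by move=> [+ _]; rewrite Ps => /conv_vert. Qed.

Let corner_lex (m m' : V -> rat) : affine m -> affine m' ->
    (forall x y, m x = m y -> m' x = m' y -> x = y) -> s != [::] ->
    (forall v (t : rat), lexle m m' (v + t *: f) v -> t <= 0) ->
  exists2 v, corner v & forall x, P x -> lexle m m' x v.
Proof.
move=> am am' inj s0 mf; have [v vv vmax] := lex_vertex am am' inj s0.
rewrite -Ps in vv vmax; exists v => //; split=> //; split; first by case: vv.
by move=> t /vmax /mf.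
Qed.

Let height_inj u v : corner u -> corner v -> Y u = Y v -> u = v.
Proof. by move=> [_ ru] [_ rv]; exact: (rightmost_inj ru rv). Qed.

Let corner_between u v w (t : rat) : corner v -> P u -> P w -> 0 <= t <= 1 ->
  Y v = t * Y u + (1 - t) * Y w -> t * X u + (1 - t) * X w <= X v.
Proof.
move=> [_ rv] Pu Pw t01 E; rewrite -(abscissa_affine fr).
by apply: (rightmost_abscissa rv); [exact: cP|rewrite E (height_affine fr)].
Qed.

(** The form [side u v] increases along the axis, so its maximum on P is attained
    at corners. Such a corner w is u or v: otherwise it is strictly above v or
    strictly below u, and the middle one of the corners u, v, w is either not
    rightmost or interior to the segment between the other two. *)
Let corner_edge u v (eps : rat) :
    P 0 -> 0 < eps -> P (eps *: f) -> corner u -> corner v -> Y u < Y v ->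
    (forall w, corner w -> Y w <= Y u \/ Y v <= Y w) ->
  ccw_edge e P u v.
Proof.
move=> P0 eps0 Peps cu cv uv gap.
have [[Pu _] _] := cu; have [[Pv _] _] := cv.
have s0 : s != [::] by apply/eqP => s0; have := corner_mem cu; rewrite s0.
have sf w t : side fr u v (w + t *: f) = side fr u v w + t * (Y v - Y u).
  by rewrite /side !coordE; ring.
have inj x y : side fr u v x = side fr u v y -> Y x = Y y -> x = y.
  by apply: side_height_inj; rewrite lt_eqF.
have suv : side fr u v v = side fr u v u by rewrite /side; ring.
(* w and w' are the highest and the lowest maximum point of the form. *)
have [w cw wmax] : exists2 w, corner w & forall x, P x -> lexle (side fr u v) Y x w.
  apply: corner_lex => //; [exact: side_affine|exact: height_affine|].
  by move=> w t [|[+ _]]; rewrite sf; nra.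
have [w' cw' wmin] : exists2 w, corner w &
    forall x, P x -> lexle (side fr u v) (fun x => - Y x) x w.
  apply: corner_lex => //; first exact: side_affine.
  - by move=> x y t; rewrite (height_affine fr); ring.
  - by move=> x y E /oppr_inj; exact: inj.
  by move=> z t [|[+ _]]; rewrite sf; nra.
have Pw : P w by case: cw => -[].
have Pw' : P w' by case: cw' => -[].
have low z : corner z -> side fr u v u <= side fr u v z -> Y z <= Y u -> z = u.
  move=> cz sz; rewrite le_eqVlt => /predU1P[/(height_inj cz cu)//|zu].
  have [[Pz _] _] := cz.
  pose t := (Y v - Y u) / (Y v - Y z).
  have D : Y v - Y z != 0 by lra.
  have t01 : 0 < t < 1.
    by rewrite /t divr_gt0 ?ltr_pdivrMr /=; lra.
  have Yu : Y u = t * Y z + (1 - t) * Y v by rewrite /t; field.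
  have t01' : 0 <= t <= 1 by lra.
  have := corner_between cu Pz Pv t01' Yu => Xu.
  have Es : side fr u v (t *: z + (1 - t) *: v) = t * side fr u v z + (1 - t) * side fr u v v.
    exact: side_affine.
  have su : side fr u v (t *: z + (1 - t) *: v) <= side fr u v u.
    by rewrite {1}/side !coordE -Yu /side; nra.
  have sz' : side fr u v z = side fr u v u by rewrite suv in Es; nra.
  have uE : u = t *: z + (1 - t) *: v.
    apply: inj; first by rewrite Es suv sz'; ring.
    by rewrite !coordE.
  by have [] := cu.1.2 _ _ _ Pz Pv t01 uE.
have high z : corner z -> side fr u v u <= side fr u v z -> Y v <= Y z -> z = v.
  move=> cz sz; rewrite le_eqVlt => /predU1P[/(height_inj cv cz)//|zv].
  have [[Pz _] _] := cz.
  pose t := (Y v - Y u) / (Y z - Y u).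
  have D : Y z - Y u != 0 by lra.
  have t01 : 0 < t < 1.
    by rewrite /t divr_gt0 ?ltr_pdivrMr /=; lra.
  have Yv : Y v = t * Y z + (1 - t) * Y u by rewrite /t; field.
  have t01' : 0 <= t <= 1 by lra.
  have := corner_between cv Pz Pu t01' Yv => Xv.
  have Es : side fr u v (t *: z + (1 - t) *: u) = t * side fr u v z + (1 - t) * side fr u v u.
    exact: side_affine.
  have su : side fr u v (t *: z + (1 - t) *: u) <= side fr u v v.
    by rewrite {1}/side !coordE -Yv /side; nra.
  have sz' : side fr u v z = side fr u v u by rewrite suv in su; nra.
  have vE : v = t *: z + (1 - t) *: u.
    apply: inj; first by rewrite Es suv sz'; ring.
    by rewrite !coordE.
  by have [] := cv.1.2 _ _ _ Pz Pu t01 vE.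
have sle x : P x -> side fr u v x <= side fr u v w by move=> /wmax[/ltW//|[->]].
have sle' x : P x -> side fr u v x <= side fr u v w' by move=> /wmin[/ltW//|[->]].
have wE : w = u \/ w = v.
  by case: (gap _ cw) => ?; [left; apply: low|right; apply: high] => //; exact: sle.
have wE' : w' = u \/ w' = v.
  by case: (gap _ cw') => ?; [left; apply: low|right; apply: high] => //; exact: sle'.
have top x : P x -> side fr u v x <= side fr u v u.
  by move=> /sle; case: wE => -> //; rewrite suv.
have D : 0 < det e u v.
  have -> : det e u v = side fr u v u by rewrite (detE fr) /side; ring.
  by apply: lt_le_trans (top _ Peps); rewrite /side !coordE; nra.
apply/(ccw_edgeP fr) => //; split=> // x Px; split; first exact: top.
move=> sx; apply/conv2P.
have hx : Y u <= Y x <= Y v.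
  apply/andP; split.
    by case: (wmin x Px) => [|[_]]; case: wE' => ->; rewrite ?suv ?sx ?ltxx //; lra.
  by case: (wmax x Px) => [|[_]]; case: wE => ->; rewrite ?suv ?sx ?ltxx //; lra.
pose t := (Y v - Y x) / (Y v - Y u).
have D' : Y v - Y u != 0 by lra.
exists t.
  by rewrite /t divr_ge0 ?ler_pdivrMr /=; lra.
apply: inj; first by rewrite side_affine suv sx; ring.
by rewrite !coordE /t; field.
Qed.

(** The chain is the list of the rightmost vertices, sorted by height. *)
Lemma right_chain_exists (kmin kmax eps : rat) :
    P 0 -> 0 < eps -> P (eps *: f) ->
    (exists2 x, P x & Y x = kmin) -> (forall x, P x -> kmin <= Y x) ->
    (exists2 x, P x & Y x = kmax) -> (forall x, P x -> Y x <= kmax) ->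
  exists r R, right_chain fr P kmin kmax r R.
Proof.
move=> P0 eps0 Peps [a Pa Ya] lo [b Pb Yb] hi.
have s0 : s != [::].
  by apply/eqP => s0; move: P0; rewrite Ps s0 set_nil conv_set0.
have [bot cbot Ybot] : exists2 v, corner v & Y v = kmin.
  have [||||v cv vmax] := @corner_lex (fun x => - Y x) X _ _ _ s0.
  - by move=> x y t; rewrite (height_affine fr); ring.
  - exact: abscissa_affine.
  - by move=> x y /oppr_inj E1 E2; exact: (coord_inj fr E2 E1).
  - by move=> v t [|[_]]; rewrite !coordE; lra.
  exists v => //; have [[Pv _] _] := cv.
  by have := lo _ Pv; case: (vmax _ Pa) => [|[]]; lra.
have [tp ctop Ytop] : exists2 v, corner v & Y v = kmax.
  have [||||v cv vmax] := @corner_lex Y X _ _ _ s0.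
  - exact: height_affine.
  - exact: abscissa_affine.
  - by move=> x y E1 E2; exact: (coord_inj fr E2 E1).
  - by move=> v t [|[_]]; rewrite !coordE; lra.
  exists v => //; have [[Pv _] _] := cv.
  by have := hi _ Pv; case: (vmax _ Pb) => [|[]]; lra.
pose le_h := fun u v : V => Y u <= Y v.
pose S := sort le_h [seq v <- undup s | `[< corner v >]].
have memS v : v \in S <-> corner v.
  rewrite mem_sort mem_filter mem_undup; split=> [/andP[/asboolP]//|cv].
  apply/andP; split; first exact/asboolP.
  exact: corner_mem.
have uS : uniq S by rewrite sort_uniq filter_uniq // undup_uniq.
have sS : sorted le_h S by apply: sort_sorted => x y; exact: le_total.
have leS i j : (i <= j < size S)%N -> Y (nth 0 S i) <= Y (nth 0 S j).
  move=> /andP[ij jS].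
  apply: (@sorted_leq_nth _ le_h _ _ 0 S sS i j) => //.
  - by move=> x y z; exact: le_trans.
  - by move=> x; exact: lexx.
  - by rewrite inE (leq_ltn_trans ij).
have ltS i j : (i < j < size S)%N -> Y (nth 0 S i) < Y (nth 0 S j).
  move=> /andP[ij jS]; have iS := ltn_trans ij jS.
  rewrite lt_neqAle leS ?(ltnW ij) // andbT; apply/eqP => E.
  have : nth 0 S i = nth 0 S j by apply: height_inj => //; apply/memS/mem_nth.
  by move/eqP; rewrite nth_uniq // ltn_eqF.
have minS v : v \in S -> Y (nth 0 S 0) <= Y v.
  by move=> vS; rewrite -(nth_index 0 vS); apply: leS; rewrite index_mem.
have maxS v : v \in S -> Y v <= Y (nth 0 S (size S).-1).
  move=> vS; rewrite -(nth_index 0 vS); apply: leS.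
  have : (index v S < size S)%N by rewrite index_mem.
  by case: (size S) => //= n; rewrite ltnS => ->; rewrite leqnn.
move: memS leS ltS minS maxS; case: S {uS sS} => [|r R] memS leS ltS minS maxS.
  by have := (memS bot).2 cbot.
exists r, R; split.
- apply/(pathP 0) => i iR; rewrite /right_step (ltS i i.+1) ?leqnn //=.
  apply/asboolP; apply: (corner_edge P0 eps0 Peps).
  + by apply/memS/mem_nth; rewrite ltnW.
  + exact/memS/(@mem_nth _ 0 (r :: R) i.+1).
  + by apply: (ltS i i.+1); rewrite leqnn.
  move=> w /memS wS; rewrite -(nth_index 0 wS).
  have : (index w (r :: R) < size (r :: R))%N by rewrite index_mem.
  move: (index _ _) => j jS; have [ji|ij] := leqP j i; [left|right].
    by apply: leS; rewrite ji ltnW.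
  by apply: (leS i.+1 j); rewrite ij.
- have [[Pr _] _] := (memS r).1 (mem_head _ _).
  apply: le_anti; rewrite lo // andbT -Ybot.
  by apply: (minS bot); apply/memS.
- rewrite (last_nth 0); have L : nth 0 (r :: R) (size R) \in r :: R by rewrite mem_nth.
  have [[Pr _] _] := (memS _).1 L.
  apply: le_anti; rewrite hi //= -Ytop.
  by apply: (maxS tp); apply/memS.
- by move=> x /memS[].
Qed.

End Existence.
End RightChains.

(** * Closed walks and cyclic lists *)

Section ClosedWalks.
Variable T : eqType.
Implicit Types (x u v r l : T) (p R L : seq T).

Lemma cycle_belast (a : rel T) x p :
  last x p = x -> cycle a (belast x p) = path a x p.
Proof.
by case: p => [//|w p] /= E; rewrite -[X in rcons _ X]E -lastI.
Qed.

Lemma perm_belast x p : p != [::] -> last x p = x -> perm_eq (belast x p) p.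
Proof.
case: p => //= w p _ E; by rewrite [w :: p]lastI E perm_sym perm_rcons.
Qed.

Lemma next_belast x p : last x p = x -> uniq (belast x p) ->
  [seq (v, next (belast x p) v) | v <- belast x p] = pairmap pair x p.
Proof.
case/lastP: p => [//|t y]; rewrite last_rcons => ->; rewrite belast_rcons => u.
apply: (@eq_from_nth _ (x, x)) => [|i]; rewrite size_map ?size_pairmap ?size_rcons // => it.
rewrite (nth_map x) // (nth_pairmap x) ?size_rcons // next_nth mem_nth // index_uniq //.
rewrite -rcons_cons !nth_rcons it; congr (_, _).
by move: it; rewrite /= ltnS leq_eqVlt => /predU1P[->|->//]; rewrite ltnn eqxx nth_default.
Qed.

Definition skip u v : seq T := if v == u then [::] else [:: v].

(** The jumps from the end of one chain to the start of the other may be trivial;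
    [boundary_walk] leaves out the trivial ones. *)
Definition closed_walk r R l L : seq T := R ++ l :: rcons L r.

Definition boundary_walk r R l L : seq T :=
  R ++ skip (last r R) l ++ L ++ skip (last l L) r.

Lemma boundary_walk_nonempty r R l L : R != [::] -> boundary_walk r R l L != [::].
Proof. by case: R. Qed.

Lemma last_skip u v : last u (skip u v) = v.
Proof. by rewrite /skip; case: eqP. Qed.

Lemma last_boundary_walk r R l L : last r (boundary_walk r R l L) = r.
Proof. by rewrite !last_cat !last_skip. Qed.

Lemma filter_boundary_walk r R l L (a : pred (T * T)) :
    (forall u, ~~ a (u, u)) ->
  seq.filter a (pairmap pair r (boundary_walk r R l L))
  = seq.filter a (pairmap pair r (closed_walk r R l L)).
Proof.
move=> a0; rewrite /boundary_walk /closed_walk !pairmap_cat !filter_cat; congr (_ ++ _).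
rewrite last_skip -cats1 /= [in RHS]pairmap_cat.
have skipE u v : seq.filter a (pairmap pair u (skip u v)) = seq.filter a [:: (u, v)].
  by rewrite /skip; case: eqP => // ->; rewrite /= (negPf (a0 _)).
by rewrite !skipE /= filter_cat; case: (a _).
Qed.

Lemma mem_boundary_walk r R l L x : R != [::] ->
  (x \in boundary_walk r R l L) = (x \in r :: R) || (x \in l :: L).
Proof.
move=> R0; have lR : last r R \in R by case: R R0 => //= a R _; exact: mem_last.
have rW : r \in boundary_walk r R l L.
  have := last_boundary_walk r R l L.
  rewrite /boundary_walk; case: R R0 {lR} => // a R _ /=.
  by move=> {1}<-; exact: mem_last.
have lW : l \in boundary_walk r R l L.
  rewrite /boundary_walk !mem_cat /skip; case: (altP (l =P _)) => [->|_].
    by rewrite lR.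
  by rewrite !inE eqxx !orbT.
have [-> |xr] := eqVneq x r; first by rewrite rW inE eqxx.
have [-> |xl] := eqVneq x l; first by rewrite lW mem_head orbT.
rewrite !inE (negPf xr) (negPf xl) /= /boundary_walk !mem_cat.
have E u v : x != v -> (x \in skip u v) = false.
  by move=> /negPf xv; rewrite /skip; case: (v == u); rewrite // inE.
by rewrite !E // orbF.
Qed.

Lemma sub_boundary_walk (a : rel T) r R l L : path a r R -> path a l L ->
    (last r R != l -> a (last r R) l) -> (last l L != r -> a (last l L) r) ->
  path a r (boundary_walk r R l L).
Proof.
move=> pR pL top bot; rewrite /boundary_walk !cat_path pR last_skip pL /=.
rewrite /skip; apply/andP; split; case: eqP => //= /eqP; rewrite eq_sym.
  by move/top->.
by move/bot->.
Qed.

End ClosedWalks.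

(** * From the two chains to the boundary cycle *)

Section PolygonBoundary.
Variables (V : vectType rat) (e : 2.-tuple V).
Implicit Types (fr : frame e) (P : set V) (u v x r l : V) (s R L : seq V).

(** The left chain, listed from top to bottom, is the right chain for the opposite
    frame. The chains share an endpoint when the highest or the lowest face of P
    is a vertex; otherwise that face is the edge that joins them. *)
Record polygon_chains fr P (kmin kmax : rat) r R l L : Prop := PolygonChains {
  polygon_convex : convex P;
  polygon_origin : P 0;
  polygon_bottom_lt0 : kmin < 0;
  polygon_top_gt0 : 0 < kmax;
  polygon_height x : P x -> kmin <= cy fr x <= kmax;
  polygon_right : right_chain fr P kmin kmax r R;
  polygon_left : right_chain (opp_frame fr) P (- kmax) (- kmin) l L
}.

Lemma polygon_chains_opp fr P kmin kmax r R l L :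
  polygon_chains fr P kmin kmax r R l L ->
  polygon_chains (opp_frame fr) P (- kmax) (- kmin) l L r R.
Proof.
case=> cP P0 kmin0 kmax0 hP [pR bR tR rR] lc; split=> //; rewrite ?oppr_lt0 ?oppr_gt0 //.
  by move=> x /hP; rewrite cy_opp !lerN2 andbC.
rewrite !opprK.
split=> [|||x xR].
- by apply: sub_path pR => u v; rewrite /right_step !cy_opp !opprK.
- by rewrite !cy_opp opprK.
- by rewrite !cy_opp opprK.
- by rewrite /= opprK; exact: rR.
Qed.

Lemma top_edge fr P (k : rat) u v : convex P -> P 0 -> 0 < k ->
    (forall x, P x -> cy fr x <= k) -> cy fr u = k -> cy fr v = k ->
    rightmost (axis fr) P u -> rightmost (- axis fr) P v -> u != v ->
  ccw_edge e P u v.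
Proof.
move=> cP P0 k0 hk uk vk ru rv uv.
have [Pu _] := ru; have [Pv _] := rv.
have left x : P x -> cy fr x = k -> cx fr v <= cx fr x.
  move=> Px xk; have := @rightmost_abscissa _ _ (opp_frame fr) P v x rv Px.
  by rewrite !cy_opp !cx_opp lerN2; apply; rewrite xk vk.
have right x : P x -> cy fr x = k -> cx fr x <= cx fr u.
  by move=> Px xk; apply: (rightmost_abscissa ru) => //; rewrite xk uk.
have lt : cx fr v < cx fr u.
  rewrite lt_neqAle left // andbT; apply: contra uv => /eqP E.
  by apply/eqP; apply: (coord_inj fr) => //; rewrite uk vk.
have sE x : side fr u v x = cy fr x * (cx fr u - cx fr v).
  by rewrite /side uk vk; ring.
apply/(ccw_edgeP fr) => //; split=> //.
  by rewrite (detE fr) uk vk; nra.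
move=> x Px; rewrite !sE uk; split.
  by have := hk _ Px; nra.
move=> E; have xk : cy fr x = k by apply: (mulIf _ E); lra.
have := left _ Px xk; have := right _ Px xk => h1 h2.
have D : cx fr u - cx fr v != 0 by lra.
apply/conv2P; exists ((cx fr x - cx fr v) / (cx fr u - cx fr v)).
  by rewrite divr_ge0 ?ler_pdivrMr /=; lra.
by apply: (coord_inj fr); rewrite !coordE ?uk ?vk ?xk; field.
Qed.

Section Boundary.
Variables (fr : frame e) (P : set V) (kmin kmax : rat) (r l : V) (R L : seq V).
Hypothesis poly : polygon_chains fr P kmin kmax r R l L.

Let cP : convex P. Proof. by case: poly. Qed.
Let P0 : P 0. Proof. by case: poly. Qed.

Lemma chain_nonempty : R != [::].
Proof.
have [_ _ ? ? _ [_ b t _] _] := poly.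
by apply: contraTneq isT => R0; move: b t; rewrite R0 /= => ->; lra.
Qed.

Lemma chain_above_bottom x : x \in R -> kmin < cy fr x.
Proof.
have [_ _ _ _ _ [pR <- _ _] _] := poly => xR.
have : path (fun u v => cy fr u < cy fr v) r R by apply: sub_path pR => u v /andP[].
move/order_path_min => /(_ (fun a b c => @lt_trans _ _ _ _ _))/allP; exact.
Qed.

Lemma chain_uniq : uniq R.
Proof.
have [_ _ _ _ _ [pR _ _ _] _] := poly.
have : sorted (fun u v => cy fr u < cy fr v) R.
  by apply: (@path_sorted _ _ r); apply: sub_path pR => u v /andP[].
apply: sorted_uniq => [a b c|a]; [exact: lt_trans|exact: ltxx].
Qed.

Lemma right_edge_over u v x : right_step fr P u v -> P x ->
    cy fr u <= cy fr x <= cy fr v ->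
  exists y, [/\ conv [set u; v] y, cy fr y = cy fr x & cx fr x <= cx fr y].
Proof.
move=> /andP[uv /asboolP /(ccw_edgeP fr u v cP P0)[_ Pu Pv S]] Px hx.
have [sx _] := S x Px.
pose t := (cy fr v - cy fr x) / (cy fr v - cy fr u).
have D : cy fr v - cy fr u != 0 by lra.
exists (t *: u + (1 - t) *: v).
have Yy : cy fr (t *: u + (1 - t) *: v) = cy fr x by rewrite !coordE /t; field.
split=> //.
  by apply/conv2P; exists t => //; rewrite /t divr_ge0 ?ler_pdivrMr /=; lra.
have : side fr u v (t *: u + (1 - t) *: v) = side fr u v u.
  by rewrite side_affine (_ : side fr u v v = side fr u v u) /side; ring.
move=> sy; move: sx; rewrite -sy {1 2}/side Yy; nra.
Qed.

Lemma right_step_around (p : seq V) a k : path (right_step fr P) a p -> p != [::] ->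
    cy fr a <= k <= cy fr (last a p) ->
  exists u v, [/\ u \in a :: p, v \in a :: p, right_step fr P u v & cy fr u <= k <= cy fr v].
Proof.
elim: p a => // b p IHp a /= /andP[ab pb] _ /andP[ak kl].
have [kb|bk] := leP k (cy fr b).
  by exists a, b; rewrite !inE !eqxx !orbT ak kb.
have p0 : p != [::] by apply: contraTneq kl => ->; rewrite /= -ltNge.
have [u [v [up vp uv kuv]]] := IHp b pb p0 (introT andP (conj (ltW bk) kl)).
by exists u, v; rewrite !(inE, in_cons) in up vp *; rewrite up vp !orbT.
Qed.

Lemma vert_conv2 a b w : vert P w -> P a -> P b -> conv [set a; b] w -> w = a \/ w = b.
Proof.
move=> [_ ew] Pa Pb /conv2P[t t01 E].
have [t0|t0] := eqVneq t 0; first by right; rewrite E t0 scale0r add0r subr0 scale1r.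
have [t1|t1] := eqVneq t 1; first by left; rewrite E t1 subrr scale0r addr0 scale1r.
have t01' : 0 < t < 1 by lra.
by left; have [] := ew a b t Pa Pb t01' E.
Qed.

Lemma chain_reaches_right x : P x ->
  exists u v y, [/\ u \in r :: R, v \in r :: R, P u, P v
    & [/\ conv [set u; v] y, cy fr y = cy fr x & cx fr x <= cx fr y]].
Proof.
move=> Px; have [_ _ _ _ hP [pR bR tR rR] _] := poly.
have := hP _ Px; rewrite -bR -tR => kx.
have [u [v [ur vr uv kuv]]] := right_step_around pR chain_nonempty kx.
have [y yP] := right_edge_over uv Px kuv.
by exists u, v, y; split=> //; [case: (rR u ur)|case: (rR v vr)].
Qed.

(** The chains meet only at the extreme heights: if x were also leftmost, P would
    meet the line through x parallel to the axis only in x. The segment from the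
    lower end u of an edge ux to the top of the chain would then go through x, so
    the edge would go on beyond x. *)
Lemma rightmost_leftmost_false x : x \in R -> rightmost (- axis fr) P x ->
  cy fr x < kmax -> False.
Proof.
move=> xR lx xk; have [_ _ _ _ hP [pR bR tR rR] _] := poly.
have rx : rightmost (axis fr) P x by apply: rR; rewrite inE xR orbT.
have [PT _] : rightmost (axis fr) P (last r R) by apply: rR; exact: mem_last.
have [u ux] : exists u, right_step fr P u x.
  case/splitPr: xR pR => p1 p2; rewrite cat_path /= => /and3P[_ ux _].
  by exists (last r p1).
have /andP[uxh /asboolP /(ccw_edgeP fr u x cP P0)[_ Pu _ S]] := ux.
set T := last r R in tR PT *.
pose t := (cy fr T - cy fr x) / (cy fr T - cy fr u).
have D : cy fr T - cy fr u != 0 by rewrite tR; lra.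
have t01 : 0 <= t <= 1 by rewrite /t tR divr_ge0 ?ler_pdivrMr /=; lra.
have t1 : t < 1 by rewrite /t tR ltr_pdivrMr /=; lra.
have Py := cP Pu PT t01; set y := _ + _ in Py.
have Yy : cy fr y = cy fr x by rewrite /y !coordE /t; field.
have yx : y = x.
  apply: (coord_inj fr _ Yy); apply: le_anti; rewrite (rightmost_abscissa rx) //=.
  have := @rightmost_abscissa _ _ (opp_frame fr) P x y lx Py.
  by rewrite !cy_opp !cx_opp lerN2; apply; rewrite Yy.
have : side fr u x y = t * side fr u x u + (1 - t) * side fr u x T by exact: side_affine.
have -> : side fr u x y = side fr u x u by rewrite yx /side; ring.
move=> E; have sT : side fr u x T = side fr u x u by nra.
have /conv2P[t' t01' E'] := (S _ PT).2 sT.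
have : cy fr T = t' * cy fr u + (1 - t') * cy fr x by rewrite E' !coordE.
by rewrite tR; nra.
Qed.

End Boundary.

Section BoundaryCycle.
Variables (fr : frame e) (P : set V) (kmin kmax : rat) (r l : V) (R L : seq V).
Hypothesis poly : polygon_chains fr P kmin kmax r R l L.
Let poly' := polygon_chains_opp poly.
Let W := boundary_walk r R l L.

Lemma boundary_walk_uniq : uniq W.
Proof.
have [cP P0 kmin0 kmax0 hP [pR bR tR rR] [pL bL tL rL]] := poly.
have hR x : x \in R -> kmin < cy fr x by exact: (chain_above_bottom poly).
have hL x : x \in L -> cy fr x < kmax.
  by move=> /(chain_above_bottom poly'); rewrite cy_opp ltrN2.
have rR' x : x \in R -> rightmost (axis fr) P x by move=> xR; apply: rR; rewrite inE xR orbT.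
have rL' x : x \in L -> rightmost (- axis fr) P x by move=> xL; apply: rL; rewrite inE xL orbT.
have bR' : cy fr r = kmin by [].
have bL' : cy fr l = kmax by move: bL; rewrite cy_opp => /oppr_inj.
have tL' : cy fr (last l L) = kmin by move: tL; rewrite cy_opp => /oppr_inj.
have skip_uniq (u v : V) : uniq (skip u v) by rewrite /skip; case: eqP.
have mem_skip (x u v : V) : x \in skip u v -> x = v /\ v != u.
  by rewrite /skip; case: eqP => //= /eqP vu; rewrite inE => /eqP.
rewrite /W /boundary_walk !cat_uniq (chain_uniq poly) (chain_uniq poly') !skip_uniq /= !andbT.
apply/and3P; split; apply/hasPn => x; rewrite ?mem_cat.
- case/or3P => [/mem_skip[-> lne]|xL|/mem_skip[-> rne]]; apply/negP => xR.
  + case/eqP: lne; apply: (rightmost_inj (rR' _ xR)); first by apply: rR; exact: mem_last.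
    by rewrite bL' tR.
  + exact: (rightmost_leftmost_false poly xR (rL' _ xL) (hL _ xL)).
  + by have := hR _ xR; rewrite bR' ltxx.
- case/orP => [xL|/mem_skip[-> _]]; apply/negP => /mem_skip[E _].
    by have := hL _ xL; rewrite E bL' ltxx.
  by move: bR'; rewrite E bL'; lra.
- move=> /mem_skip[-> rne]; apply/negP => rL0.
  case/eqP: rne; apply: (@rightmost_inj _ _ (opp_frame fr) P); first exact: rL' _ rL0.
    by apply: rL; exact: mem_last.
  by rewrite !cy_opp tL' bR'.
Qed.

Lemma boundary_walk_path : path (fun u v => `[< ccw_edge e P u v >]) r W.
Proof.
have [cP P0 kmin0 kmax0 hP [pR bR tR rR] [pL bL tL rL]] := poly.
apply: sub_boundary_walk.
- by apply: sub_path pR => u v /andP[].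
- by apply: sub_path pL => u v /andP[].
- move=> ne; apply/asboolP; apply: (@top_edge fr P kmax) => //.
  + by move=> x /hP/andP[].
  + by move: bL; rewrite cy_opp => /oppr_inj.
  + by apply: rR; exact: mem_last.
  + by apply: rL; exact: mem_head.
- move=> ne; apply/asboolP; apply: (@top_edge (opp_frame fr) P (- kmin)) => //.
  + by rewrite oppr_gt0.
  + by move=> x /hP/andP[h _]; rewrite cy_opp lerN2.
  + by rewrite cy_opp bR.
  + by apply: rL; exact: mem_last.
  + by rewrite /= opprK; apply: rR; exact: mem_head.
Qed.

(** Every vertex w is in the list: at its height, w lies between a point of an
    edge of the right chain and a point of an edge of the left chain. Being a
    vertex, w is one of these two points, and then an end of that edge. *)
Lemma boundary_walk_cycle : boundary_cycle e P (belast r W).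
Proof.
have [cP P0 _ _ hP [_ _ _ rR] [_ _ _ rL]] := poly.
have lW : last r W = r := last_boundary_walk r R l L.
have R0 := chain_nonempty poly.
have pW := perm_belast (boundary_walk_nonempty r l L R0) lW.
have uW : uniq (belast r W) by rewrite (perm_uniq pW) boundary_walk_uniq.
have cW : cycle (fun u v => `[< ccw_edge e P u v >]) (belast r W).
  by rewrite cycle_belast // boundary_walk_path.
have edge v : v \in belast r W -> ccw_edge e P v (next (belast r W) v).
  by move=> vW; apply/asboolP; exact: next_cycle cW vW.
split=> //; rewrite eqEsubset; split=> w /=.
  by move=> /edge; exact: ccw_edge_vert.
move=> vw; rewrite (perm_mem pW) mem_boundary_walk // {edge cW uW pW lW}.
have [Pw _] := vw.
have [u [v [a [ur vr Pu Pv [ca ya xa]]]]] := chain_reaches_right poly Pw.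
have [u' [v' [b [ul vl Pu' Pv' [cb yb xb]]]]] := chain_reaches_right poly' Pw.
rewrite !cy_opp in yb; rewrite !cx_opp lerN2 in xb; move/oppr_inj: yb => yb.
have Pa : P a by apply: convex_conv2 ca.
have Pb : P b by apply: convex_conv2 cb.
have wab : conv [set a; b] w.
  have [E|D] := eqVneq (cx fr a) (cx fr b).
    have -> : w = a by apply: (coord_inj fr) => //; apply: le_anti; rewrite xa E xb.
    by apply: sub_conv; left.
  have D' : cx fr a - cx fr b != 0 by rewrite subr_eq0.
  apply/conv2P; exists ((cx fr w - cx fr b) / (cx fr a - cx fr b)).
    by rewrite divr_ge0 ?ler_pdivrMr /=; lra.
  by apply: (coord_inj fr); rewrite !coordE ?ya ?yb; field.
have [E|E] := vert_conv2 vw Pa Pb wab; subst w.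
  by have [->|->] := vert_conv2 vw Pu Pv ca; rewrite ?ur ?vr.
by have [->|->] := vert_conv2 vw Pu' Pv' cb; rewrite ?ul ?vl orbT.
Qed.

Lemma vert_chains x : vert P x <-> (x \in r :: R) || (x \in l :: L).
Proof.
have R0 := chain_nonempty poly; have [_ <- _] := boundary_walk_cycle.
rewrite /= (perm_mem (perm_belast _ _)) ?boundary_walk_nonempty ?last_boundary_walk //.
by rewrite mem_boundary_walk.
Qed.

End BoundaryCycle.
End PolygonBoundary.

(** * Singularity content as a sum over a closed walk *)

Section Rotations.

Lemma rot_rot_exists (T : Type) (s : seq T) m n : exists k, rot m (rot n s) = rot k s.
Proof.
have [ns|sn] := leqP n (size s); last by exists m; rewrite [rot n s]rot_oversize // ltnW.
have [ms|sm] := leqP m (size s).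
  by eexists; exact: rot_add_mod.
by exists n; rewrite rot_oversize // size_rot ltnW.
Qed.

Lemma pmap_rot (A B : Type) (g : A -> option B) n s :
  exists k, pmap g (rot n s) = rot k (pmap g s).
Proof.
exists (size (pmap g (take n s))).
by rewrite -{3}(cat_take_drop n s) !pmap_cat rot_size_cat.
Qed.

Lemma eq_next_rot (T : eqType) (s s' : seq T) : uniq s -> uniq s' -> s =i s' ->
  {in s, next s =1 next s'} -> exists k, s' = rot k s.
Proof.
move=> us us' ss' nss'; case: s us ss' nss' => [|x t] us ss' nss'.
  by exists 0%N; case: s' us' ss' {nss'} => // a p _ /(_ a); rewrite mem_head.
have xs' : x \in s' by rewrite -ss' mem_head.
have [i t' Et'] := rot_to xs'.
have sz : size t = size t'.
  have : size (x :: t) = size s' by apply: perm_size; apply: uniq_perm.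
  by rewrite -(size_rot i s') Et' => -[].
have pt : fpath (next (x :: t)) x t.
  by have := cycle_next us; rewrite /= rcons_path => /andP[].
have pt' : fpath (next (x :: t)) x t'.
  have : ucycle (frel (next s')) (x :: t').
    by rewrite /ucycle -Et' rot_cycle rot_uniq cycle_next.
  move=> /andP[]; rewrite /= rcons_path => /andP[+ _] _.
  rewrite (@eq_in_path _ (mem s') _ (frel (next (x :: t)))) //.
    by move=> a b as' _; rewrite -[LHS]/(next s' a == b) -nss' // ss'; exact: as'.
  by rewrite -Et'; apply/allP => y; rewrite mem_rot.
have Ett : t = t'.
  move/fpathP: pt sz => [n ->]; move/fpathP: pt' => [n' ->].
  by rewrite !size_traject => ->.
exists (size s' - i)%N; rewrite Ett -Et'.
by rewrite -[LHS](rotK i) /rotr size_rot.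
Qed.

End Rotations.

Section PrimitiveVectors.
Variables (V : vectType rat) (e : 2.-tuple V).

Lemma natr_mul_int_eq1 (d : nat) (z : rat) :
  z \is a Num.int -> d%:R * z = 1 -> d = 1%N.
Proof.
move=> /intrP[a ->]; rewrite -[d%:R]/(d%:Z%:~R) -intrM => /eqP.
rewrite (eqr_int _ _ 1) => /eqP/(congr1 absz); rewrite abszM absz_nat.
by move=> /eqP; rewrite muln_eq1 => /andP[/eqP].
Qed.

Lemma axis_primitive (fr : frame e) : primitive (lattice e) (axis fr).
Proof.
split; first by apply/(lattice_frame fr); rewrite abscissa_axis height_axis !rpred1 rpred0.
move=> d w /(lattice_frame fr)[wx _] E; apply: (natr_mul_int_eq1 wx).
by rewrite -[abscissa fr w]/(cx fr w) -cxZ -E cxf.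
Qed.

Lemma primitive_neq0 (W : lmodType rat) (L : set W) v : primitive L v -> v != 0.
Proof.
move=> [Lv pv]; apply/eqP => v0; suff : 2%N = 1%N by [].
by apply: (pv 2%N v) => //; rewrite v0 scaler0.
Qed.

Lemma width_diag (fr : frame e) u : width e u u = 0%N.
Proof.
apply: get_unique => [|w [f pf]].
  by exists (axis fr); [exact: axis_primitive|rewrite subrr scale0r].
rewrite subrr => /esym/eqP; rewrite scaler_eq0 (negPf (primitive_neq0 pf)) orbF.
by rewrite pnatr_eq0 => /eqP.
Qed.

Lemma nT_diag (fr : frame e) u : nT e u u = 0%N.
Proof. by rewrite /nT (width_diag fr) div0n. Qed.

Lemma residue_diag (fr : frame e) u : residue e u u = None.
Proof. by rewrite /residue /rho (width_diag fr) mod0n eqxx. Qed.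

End PrimitiveVectors.

Section Content.
Variables (V : vectType rat) (e : 2.-tuple V).
Implicit Types (P : set V) (s : seq V).

Lemma boundary_cycle_rot (fr : frame e) P s s' : convex P -> P 0 ->
  boundary_cycle e P s -> boundary_cycle e P s' -> exists k, s' = rot k s.
Proof.
move=> cP P0 [us sP es] [us' sP' es'].
have ss' : s =i s'.
  move=> x; apply/idP/idP => xs.
    by have : [set` s] x by []; rewrite sP -sP'.
  by have : [set` s'] x by []; rewrite sP' -sP.
apply: eq_next_rot => // v vs.
by apply: (ccw_edge_unique fr cP P0 (es v vs)); apply: es'; rewrite -ss'.
Qed.

Definition edge_content (E : seq (V * V)) : nat * seq (set (nat * int)) :=
  (\sum_(p <- E) nT e p.1 p.2, pmap (fun p => residue e p.1 p.2) E)%N.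

Lemma edge_content_filter (fr : frame e) E :
  edge_content [seq p <- E | p.1 != p.2] = edge_content E.
Proof.
rewrite /edge_content big_filter; congr (_, _).
  rewrite [RHS](bigID (fun p => p.1 != p.2)) /= [X in (_ + X)%N]big1 ?addn0 //.
  by move=> -[u v] /negPn/eqP/= ->; exact: nT_diag.
elim: E => //= -[u v] E IHE /=; case: eqP => [->|_] /=; rewrite IHE //.
by rewrite (residue_diag fr).
Qed.

(** A trivial step has width zero, hence content zero, so trivial steps may be
    kept in the walk. This makes P and its mutation comparable step by step, even
    when an edge appears or disappears. The boundary cycle is unique up to
    rotation because an edge is determined by its first end. *)
Lemma singularity_content_chains (fr : frame e) P kmin kmax r R l L :
    polygon_chains fr P kmin kmax r R l L ->
  let c := edge_content (pairmap pair r (closed_walk r R l L)) in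
  singularity_content e P = [set d | exists k, d = (c.1, rot k c.2)].
Proof.
move=> poly c; have bc := boundary_walk_cycle poly.
have [cP P0 _ _ _ _ _] := poly.
set s := belast _ _ in bc.
have Ec : edge_content [seq (v, next s v) | v <- s] = c.
  have [us _ _] := bc.
  rewrite /s next_belast ?last_boundary_walk // -(edge_content_filter fr).
  rewrite filter_boundary_walk; last by move=> u; rewrite /= eqxx.
  exact: edge_content_filter.
have c1 : (\sum_(v <- s) nT e v (next s v))%N = c.1 by rewrite -Ec /= big_map.
have c2 : pmap (fun v => residue e v (next s v)) s = c.2.
  by rewrite -Ec /=; elim: (s) (next s) => //= a p IHp g; rewrite IHp.
rewrite eqEsubset; split=> d [].
  move=> s' [k [bc' ->]]; have [i Es'] := boundary_cycle_rot fr cP P0 bc bc'.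
  have [us _ _] := bc.
  have nE v : next s' v = next s v by rewrite Es' next_rot.
  have [j Ej] := pmap_rot (fun v => residue e v (next s v)) i s.
  have [k' Ek'] := rot_rot_exists c.2 k j.
  exists k'; congr (_, _).
    rewrite -c1 {1}Es' (perm_big s) ?perm_rot //=.
    by apply: eq_bigr => v _; rewrite nE.
  rewrite -Ek' -c2 -Ej -Es'; congr (rot k _).
  by apply: eq_pmap => v; rewrite nE.
by move=> k ->; exists s, k; split=> //; rewrite c1 c2.
Qed.

End Content.

(** * Invariance under lattice automorphisms *)

Section LatticeAutomorphisms.
Variables (V : vectType rat) (e : 2.-tuple V).
Implicit Types (a b : 'End(V)) (u v : V).

Definition lattice_auto a b : Prop :=
  [/\ cancel a b, cancel b a & forall x, lattice e (a x) <-> lattice e x].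

Lemma lattice_auto_sym a b : lattice_auto a b -> lattice_auto b a.
Proof. by case=> ab ba L; split=> // x; rewrite -[in X in _ <-> X](ba x) L. Qed.

Lemma primitive_auto a b v : lattice_auto a b ->
  primitive (lattice e) v -> primitive (lattice e) (a v).
Proof.
move=> ab [Lv pv]; have [_ _ Lb] := lattice_auto_sym ab; case: ab => ab ba La.
split=> [|d w Lw E]; first exact/La.
by apply: (pv d (b w)); [exact/Lb|rewrite -{1}(ab v) E linearZ].
Qed.

Lemma dual_primitive_auto a b (m : 'Hom(V, rat^o)) : lattice_auto a b ->
  primitive (dual_lattice e) m -> primitive (dual_lattice e) (m \o b)%VF.
Proof.
move=> ab [Lm pm]; have [_ _ Lb] := lattice_auto_sym ab; case: ab => ab ba La.
split=> [x Lx|d w Lw E]; first by rewrite comp_lfunE; apply/Lm/Lb.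
apply: (pm d (w \o a)%VF) => [x Lx|]; first by rewrite comp_lfunE; apply/Lw/La.
apply/lfunP => x; rewrite scale_lfunE comp_lfunE -scale_lfunE -E comp_lfunE /=.
by rewrite ab.
Qed.

Lemma width_auto a b u v : lattice_auto a b -> width e (a u) (a v) = width e u v.
Proof.
move=> ab; have ba := lattice_auto_sym ab; have [K K' _] := ab.
congr get; rewrite eqEsubset; split=> w [f pf E].
  exists (b f); first exact: primitive_auto ba pf.
  by apply: (can_inj K); rewrite linearB E linearZ /= K'.
exists (a f); first exact: primitive_auto ab pf.
by rewrite -linearB E linearZ.
Qed.

Lemma local_index_auto a b u v : lattice_auto a b ->
  local_index e (a u) (a v) = local_index e u v.
Proof.
move=> ab; have ba := lattice_auto_sym ab; have [K K' _] := ab.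
congr get; rewrite eqEsubset; split=> l [m pm [mu mv]].
  exists (m \o a)%VF; first exact: dual_primitive_auto ba pm.
  by rewrite !comp_lfunE.
exists (m \o b)%VF; first exact: dual_primitive_auto ab pm.
by rewrite !comp_lfunE !K.
Qed.

Lemma singularity_type_auto a b u v r k : lattice_auto a b ->
  has_singularity_type e u v r k -> has_singularity_type e (a u) (a v) r k.
Proof.
move=> ab [r0 rk H]; have [_ _ Lb] := lattice_auto_sym ab; have [K K' _] := ab.
have D (g : 'End(V)) y z : g (y + z) = g y + g z by rewrite linearD.
have Z (g : 'End(V)) (t : rat) y : g (t *: y) = t *: g y by rewrite linearZ.
split=> // x; rewrite -Lb H; split=> -[i [j [n E]]]; exists i, j, n.
  by rewrite -[LHS]K' E !(D, Z).
by rewrite E; rewrite !(D, Z) !K.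
Qed.

Lemma nT_auto a b u v : lattice_auto a b -> nT e (a u) (a v) = nT e u v.
Proof. by move=> ab; rewrite /nT (width_auto _ _ ab) (local_index_auto _ _ ab). Qed.

Lemma residue_auto a b u v : lattice_auto a b -> residue e (a u) (a v) = residue e u v.
Proof.
move=> ab; have ba := lattice_auto_sym ab; have [K K' _] := ab.
rewrite /residue /rho (width_auto _ _ ab) (local_index_auto _ _ ab).
case: eqP => // _; congr Some; rewrite eqEsubset; split=> p [r [k [st cl]]]; exists r, k.
  by split=> //; rewrite -(K u) -(K v); exact: singularity_type_auto ba st.
by split=> //; exact: singularity_type_auto ab st.
Qed.

End LatticeAutomorphisms.

Section Shears.
Variables (V : vectType rat) (e : 2.-tuple V) (fr : frame e).

Definition shear_map (c : rat) (x : V) : V := x + (c * cy fr x) *: axis fr.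

Lemma shear_map_linear c : linear (shear_map c).
Proof.
move=> t x y; apply: (coord_inj fr); rewrite /shear_map !coordE; ring.
Qed.

HB.instance Definition _ c :=
  GRing.isLinear.Build rat V V *:%R (shear_map c) (shear_map_linear c).

Definition shear c : 'End(V) := linfun (shear_map c).

Lemma shearE c x : shear c x = x + (c * cy fr x) *: axis fr.
Proof. exact: lfunE. Qed.

Lemma cx_shear c x : cx fr (shear c x) = cx fr x + c * cy fr x.
Proof. by rewrite shearE !coordE mulr1. Qed.

Lemma cy_shear c x : cy fr (shear c x) = cy fr x.
Proof. by rewrite shearE !coordE mulr0 addr0. Qed.

Lemma shearK c : cancel (shear c) (shear (- c)).
Proof.
by move=> x; apply: (coord_inj fr); rewrite ?(cx_shear, cy_shear); ring.
Qed.

Lemma shear_lattice_auto (c : rat) : c \is a Num.int ->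
  lattice_auto e (shear c) (shear (- c)).
Proof.
move=> ci; split; first exact: shearK.
  by move=> x; rewrite -{1}[c]opprK shearK.
move=> x; split=> /(lattice_frame fr)[xi yi]; apply/(lattice_frame fr).
  rewrite -[height fr x]/(cy fr x) -(cy_shear c x); split=> //.
  rewrite -[abscissa fr x]/(cx fr x) -[cx fr x](addrK (c * cy fr x)) -cx_shear.
  by rewrite rpredB // rpredM // -(cy_shear c x).
rewrite -[height fr _]/(cy fr (shear c x)) cy_shear; split=> //.
rewrite -[abscissa fr _]/(cx fr (shear c x)) cx_shear.
by rewrite rpredD // rpredM.
Qed.

End Shears.

(** * Cones over horizontal segments *)

Section HorizontalCones.
Variables (V : vectType rat) (e : 2.-tuple V) (fr : frame e).
Implicit Types (u v : V) (k w r : nat).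
Local Notation X := (cx fr).
Local Notation Y := (cy fr).
Local Notation f := (axis fr).

Lemma latticeP v :
  lattice e v <-> exists x y : int, X v = x%:~R /\ Y v = y%:~R.
Proof.
split=> [/(lattice_frame fr)[/intrP[x xE] /intrP[y yE]]|[x [y [xE yE]]]].
  by exists x, y.
by apply/(lattice_frame fr); rewrite -[abscissa fr v]/(X v) -[height fr v]/(Y v) xE yE.
Qed.

Lemma point_of (a b : rat) : exists v, X v = a /\ Y v = b.
Proof.
exists (a *: f + b *: coaxis fr); rewrite !coordE.
by rewrite /cx /cy abscissa_coaxis height_coaxis; split; ring.
Qed.

Lemma primitive_coprime v : primitive (lattice e) v ->
  exists x y : int, [/\ X v = x%:~R, Y v = y%:~R & coprimez x y].
Proof.
move=> pv; have [/latticeP[x [y [xE yE]]] p1] := pv.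
exists x, y; split=> //; rewrite /coprimez.
have dx : (gcdz x y %| x)%Z := dvdz_gcdl _ _.
have dy : (gcdz x y %| y)%Z := dvdz_gcdr _ _.
have [w [wx wy]] := point_of (x %/ gcdz x y)%Z%:~R (y %/ gcdz x y)%Z%:~R.
apply/eqP; congr (_%:Z); apply: (p1 (gcdn `|x| `|y|) w).
  by apply/latticeP; exists (x %/ gcdz x y)%Z, (y %/ gcdz x y)%Z.
apply: (coord_inj fr); rewrite coordE ?wx ?wy -[(gcdn _ _)%:R]/((gcdz x y)%:~R : rat) -intrM.
  by rewrite mulrC divzK.
by rewrite mulrC divzK.
Qed.

Lemma height_primitive : primitive (dual_lattice e) (height fr).
Proof.
split=> [x /(lattice_frame fr)[]//|d m dm E].
have [g [gx gy]] := point_of 0 1.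
have gL : lattice e g by apply/latticeP; exists 0, 1.
apply: (natr_mul_int_eq1 (dm g gL)).
by move: gy; rewrite /cy E scale_lfunE.
Qed.

(** If w' > 0, a primitive f' with w' f' = - w f is parallel to f, so f' = f or
    f' = - f. *)
Lemma width_horizontal u w : width e u (u - w%:R *: f) = w.
Proof.
apply: get_unique => [|w' [f' pf' E]].
  exists (- f); last by rewrite addrC addKr scalerN.
  have [fL pf] := axis_primitive fr; split; first by move=> i; rewrite linearN rpredN; apply: fL.
  move=> d z zL E; apply: (pf d (- z)); first by move=> i; rewrite linearN rpredN; apply: zL.
  by rewrite scalerN -E opprK.
have EX : - (w%:R : rat) = w'%:R * X f'.
  by rewrite -cxZ -E !coordE; ring.
have EY : 0 = (w'%:R : rat) * Y f'.
  by rewrite -cyZ -E !coordE; ring.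
have [w'0|w'n0] := eqVneq w' 0%N.
  by move/eqP: EX; rewrite w'0 mul0r oppr_eq0 pnatr_eq0 => /eqP.
have Y0 : Y f' = 0.
  by move/esym/eqP: EY; rewrite mulf_eq0 pnatr_eq0 (negPf w'n0) => /eqP.
have [x [y [xE yE]]] := primitive_coprime pf'.
have -> : y = 0 by move: yE; rewrite Y0 => /esym/eqP; rewrite intr_eq0 => /eqP.
rewrite /coprimez gcdz0 => /eqP x1; move: EX; rewrite xE => EX.
have : - w%:Z = w'%:Z * x by apply/eqP; rewrite -(eqr_int rat) intrM intrN -EX.
by move=> /(congr1 absz); rewrite abszN abszM !absz_nat; lia.
Qed.

(** A form that takes the same value at both ends vanishes on the axis, so up to
    sign the height is the only primitive one. *)
Lemma local_index_horizontal u k w : Y u = k%:R -> (0 < k)%N -> (0 < w)%N ->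
  local_index e u (u - w%:R *: f) = k.
Proof.
move=> uk k0 w0; apply: get_unique => [|l [m pm [mu mv]]].
  exists (height fr); first exact: height_primitive.
  by rewrite -!/(cy fr _) !coordE uk mulr0 subr0.
have mf : (m f : rat) = 0.
  have : (w%:R : rat) * m f = 0.
    have : (m (u - w%:R *: f) : rat) = m u - w%:R * m f by rewrite linearB linearZ.
    by rewrite mu mv; lra.
  by move/eqP; rewrite mulf_eq0 pnatr_eq0 -[w == _]negbK -lt0n w0 => /eqP.
have mE x : (m x : rat) = Y x * m (coaxis fr) by rewrite (functionalE fr m) mf mulr0 add0r.
have [dm p1] := pm.
have /intrP[c cE] : (m (coaxis fr) : rat) \is a Num.int.
  apply: dm; apply/latticeP; exists 0, 1.
  by rewrite /cx /cy abscissa_coaxis height_coaxis.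
have c1 : `|c|%N = 1%N.
  apply: (p1 _ ((-1) ^+ (c < 0)%R *: height fr)) => [x /(lattice_frame fr)[_ xi]|].
    rewrite scale_lfunE; apply: rpredM => //.
    by rewrite rpredX // rpredN.
  apply/lfunP => x; rewrite !scale_lfunE [LHS]mE cE.
  change (Y x * c%:~R = `|c|%:R * ((-1) ^+ (c < 0)%R * Y x)).
  by rewrite {1}[c]intEsign intrM rmorphXn rmorphN1 -pmulrn; ring.
have : (l%:R : rat) = k%:R * c%:~R by rewrite -mu mE uk cE.
move=> E; have : l%:Z = k%:Z * c by apply/eqP; rewrite -(eqr_int rat) intrM -E.
by nia.
Qed.

(** The presentations 1/r(1, a - 1) of the cone over a segment of width w at height
    k, with right end (x, k). The order r is the index w k of the sublattice
    spanned by the two ends. The vector z = (u + (a - 1) v) / r has height a / w,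
    which gives a = w b, and its abscissa is an integer if and only if
    b (w - x) = 1 modulo k. *)
Lemma horizontal_type u (x : int) k w r (a : int) :
    X u = x%:~R -> Y u = k%:R -> (0 < k)%N -> (0 < w)%N -> primitive (lattice e) u ->
  has_singularity_type e u (u - w%:R *: f) r a <->
  r = (w * k)%N /\ exists2 b : int, a = w%:Z * b & (k%:Z %| b * (w%:Z - x) - 1)%Z.
Proof.
move=> ux uk k0 w0 pu.
have wR : (w%:R : rat) != 0 by rewrite pnatr_eq0 -lt0n.
have kR : (k%:R : rat) != 0 by rewrite pnatr_eq0 -lt0n.
have fL : lattice e f by case: (axis_primitive fr).
split=> [[r0 _ H]|[-> [b ab /dvdzP kb]]].
- have rR : (r%:R : rat) != 0 by rewrite pnatr_eq0 -lt0n.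
  set v := u - _ in H; set z := r%:R^-1 *: _ in H.
  have zX : X z = r%:R^-1 * (x%:~R + (a%:~R - 1) * (x%:~R - w%:R)).
    by rewrite /z /v !coordE ux intrB; ring.
  have zY : Y z = r%:R^-1 * (a%:~R * k%:R).
    by rewrite /z /v !coordE uk intrB; ring.
  have zL : lattice e z by apply/H; exists 0, 0, 1; rewrite !scale0r !add0r scale1r.
  clearbody z.
  have [g [gX gY]] := point_of 0 1.
  have gL : lattice e g by apply/latticeP; exists 0, 1.
  have /latticeP[p [q [zp zq]]] := zL.
  have /H[i [j [n fE]]] := fL; have /H[i' [j' [n' gE]]] := gL.
  (* d is the index of the lattice spanned by u, v, z, computed as det z v. *)
  pose d : rat := w%:R * k%:R / r%:R.
  have dE : w%:R * k%:R = d * r%:R by rewrite /d; field.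
  have dint : d = (p * k%:Z - (x - w%:Z) * q)%:~R.
    rewrite intrB !intrM intrB -zp -zq zX zY /d -!pmulrn; field.
    exact: rR.
  have one : 1 = d *
      ((i * j' - i' * j) * r%:Z + (i * n' - i' * n) * (a - 1) - (j * n' - j' * n))%:~R.
    have XE (i1 j1 n1 : int) : X (i1%:~R *: u + j1%:~R *: v + n1%:~R *: z) =
      i1%:~R * x%:~R + j1%:~R * (x%:~R - w%:R)
      + n1%:~R * (r%:R^-1 * (x%:~R + (a%:~R - 1) * (x%:~R - w%:R))).
      by rewrite !(cxD, cxZ) zX /v !coordE ux; ring.
    have YE (i1 j1 n1 : int) : Y (i1%:~R *: u + j1%:~R *: v + n1%:~R *: z) =
      i1%:~R * k%:R + j1%:~R * k%:R + n1%:~R * (r%:R^-1 * (a%:~R * k%:R)).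
      by rewrite !(cyD, cyZ) zY /v !coordE uk; ring.
    transitivity (X f * Y g - X g * Y f); first by rewrite gX gY !coordE; ring.
    rewrite fE gE !XE !YE /d !(intrD, intrN, intrM) -!pmulrn; field.
    exact: rR.
  have d0 : 0 < d by rewrite /d !(mulr_gt0, invr_gt0) ?ltr0n.
  have d1 : d = 1.
    move: one d0; rewrite dint -intrM; set t := _ - _; set s := (_ + _ - _).
    move=> /esym/eqP; rewrite (eqr_int _ _ 1) ltr0z => /eqP ts t0.
    have /eqP := congr1 absz ts; rewrite abszM muln_eq1 => /andP[/eqP t1 _].
    by have -> : t = 1 by lia.
  have rE : r = (w * k)%N.
    by apply/eqP; rewrite -(eqr_nat rat) natrM dE d1 mul1r.
  split=> //; exists q.
    apply/eqP; rewrite -(eqr_int rat) intrM -zq zY rE natrM -!pmulrn; apply/eqP; field.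
    by rewrite wR kR.
  apply/dvdzP; exists (- p); apply/eqP; rewrite -(eqr_int rat) intrM !intrB intrN intrM intrB.
  rewrite -zp -zq zX zY rE natrM -!pmulrn; apply/eqP; field.
  by rewrite wR kR.
- have [c bc] : exists c : int, b * (w%:Z - x) - 1 = c * k%:Z.
    by have [c bc] := kb; exists c.
  have [x' [k' [ux' uk' cop]]] := primitive_coprime pu.
  have Ex : x' = x by apply/eqP; rewrite -(eqr_int rat) -ux -ux'.
  have Ek : k' = k by apply/eqP; rewrite -(eqr_int rat) -uk' uk.
  rewrite Ex Ek in cop; have [[s t] /= st] := coprimezP _ _ cop.
  have bc' : b%:~R * (w%:R - x%:~R) - 1 = c%:~R * k%:R :> rat.
    by have := congr1 (fun i : int => i%:~R : rat) bc; rewrite intrB !intrM intrB.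
  split.
  + by rewrite muln_gt0 w0.
  + rewrite PoszM coprimezMl ab; apply/andP; split; apply/coprimezP.
      by exists (b, -1) => /=; ring.
    exists (t + c * k%:Z * t - c - (w%:Z - x) * s * c, (w%:Z - x) * s) => /=.
    have -> : w%:Z * b - 1 = b * x + c * k%:Z by rewrite -bc; ring.
    have -> : (w%:Z - x) * s * (b * x + c * k%:Z) =
      (b * (w%:Z - x) - 1 + 1) * (s * x) + (w%:Z - x) * s * c * k%:Z by ring.
    rewrite bc; have -> : s * x = 1 - t * k%:Z by rewrite -st; ring.
    ring.
  have zX : X ((w * k)%:R^-1 *: (u + (a - 1)%:~R *: (u - w%:R *: f))) = (- c)%:~R.
    rewrite !coordE ux ab intrB intrM natrM intrN -!pmulrn.
    have -> : c%:~R = (b%:~R * (w%:R - x%:~R) - 1) / k%:R :> rat by rewrite bc'; field.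
    by field; rewrite wR kR.
  have zY : Y ((w * k)%:R^-1 *: (u + (a - 1)%:~R *: (u - w%:R *: f))) = b%:~R.
    rewrite !coordE uk ab intrB intrM natrM -!pmulrn.
    by field; rewrite wR kR.
  move: (_%:R^-1 *: _) zX zY => z zX zY.
  move=> y; split=> [/latticeP[p [q [yp yq]]]|[i [j [n ->]]]].
    (* The pair (- b, - c) is a Bezout relation for v = (x - w, k). *)
    exists 0, (- (b * p) - c * q), (p * k%:Z + q * (w%:Z - x)).
    apply: (coord_inj fr); rewrite scale0r add0r.
      rewrite !coordE zX yp ux.
      rewrite !(intrD, intrN, intrM) -!pmulrn.
      transitivity (p%:~R * (b%:~R * (w%:R - x%:~R) - c%:~R * k%:R) : rat); last by ring.
      by rewrite -bc'; ring.
    rewrite !coordE zY yq uk.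
    rewrite !(intrD, intrN, intrM) -!pmulrn.
    transitivity (q%:~R * (b%:~R * (w%:R - x%:~R) - c%:~R * k%:R) : rat); last by ring.
    by rewrite -bc'; ring.
  apply/latticeP; exists (i * x + j * (x - w%:Z) - n * c), (i * k%:Z + j * k%:Z + n * b).
  rewrite !coordE zX zY ux uk.
  by rewrite !(intrD, intrN, intrM); split; rewrite -?pmulrn; ring.
Qed.

End HorizontalCones.

(** * How horizontal edges change *)

Section HorizontalSteps.
Variables (V : vectType rat) (e : 2.-tuple V) (fr : frame e).
Implicit Types (u v : V) (k w : nat).
Local Notation X := (cx fr).
Local Notation Y := (cy fr).
Local Notation f := (axis fr).

Lemma nT_horizontal u k w : Y u = k%:R -> (0 < k)%N ->
  nT e u (u - w%:R *: f) = (w %/ k)%N.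
Proof.
move=> uk k0; rewrite /nT width_horizontal; case: w => [|w]; first by rewrite !div0n.
by rewrite (local_index_horizontal uk).
Qed.

Lemma rho_horizontal u k w : Y u = k%:R -> (0 < k)%N ->
  rho e u (u - w%:R *: f) = (w %% k)%N.
Proof.
move=> uk k0; rewrite /rho width_horizontal; case: w => [|w]; first by rewrite !mod0n.
by rewrite (local_index_horizontal uk).
Qed.

(** In terms of the presentations a = w b, the residue has weight
    rho a / w - 1 = rho b - 1 with rho = w mod k. For x - w fixed, the right-hand
    side thus depends on w only modulo k. *)
Lemma residue_horizontal u (x : int) k w :
    X u = x%:~R -> Y u = k%:R -> (0 < k)%N -> primitive (lattice e) u ->
  residue e u (u - w%:R *: f) =
  if (w %% k == 0)%N then None else
  Some [set p | exists2 b : int, (k%:Z %| b * (w%:Z - x) - 1)%Z &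
          singularity_class (w %% k * k)%N ((w %% k)%:Z * b - 1) p].
Proof.
move=> ux uk k0 pu; rewrite /residue (rho_horizontal w uk k0).
case: eqP => // wk; congr Some.
have w0 : (0 < w)%N by case: w wk => //; rewrite mod0n.
rewrite width_horizontal (local_index_horizontal uk) //.
have wb b : ((w %% k)%:Z * (w%:Z * b) %/ w%:Z)%Z = (w %% k)%:Z * b.
  by rewrite mulrCA mulKz // -lt0n.
rewrite eqEsubset; split=> p.
  move=> [r [a [/(horizontal_type r a ux uk k0 w0 pu)[_ [b -> kb]]]]].
  by rewrite wb; exists b.
move=> [b kb cl]; exists (w * k)%N, (w%:Z * b); rewrite wb; split=> //.
by apply/(horizontal_type _ _ ux uk k0 w0 pu); split=> //; exists b.
Qed.

(** Shearing the two ends of a segment at height k by a and b changes its width by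
    k (a - b), a multiple of the local index. After undoing the shear of v, the
    end v stays in place, so x - w is preserved and w keeps its class modulo k. *)
Lemma horizontal_step (a b : int) u v :
    primitive (lattice e) u -> lattice e v -> 0 < Y u -> Y v = Y u -> X v <= X u ->
    X (shear fr b%:~R v) <= X (shear fr a%:~R u) ->
  residue e (shear fr a%:~R u) (shear fr b%:~R v) = residue e u v /\
  (nT e (shear fr a%:~R u) (shear fr b%:~R v))%:Z = (nT e u v)%:Z + (a - b).
Proof.
move=> pu vL u0 uv vu; rewrite !cx_shear => vu'.
have [x [y [ux uy _]]] := primitive_coprime fr pu.
have /(latticeP fr)[x' [y' [vx vy]]] := vL.
have [k yk] : exists k : nat, y = k%:Z.
  by exists `|y|%N; rewrite gez0_abs // -(ler0z rat) -uy ltW.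
have uk : Y u = k%:R by rewrite uy yk.
have k0 : (0 < k)%N by rewrite -(ltr_nat rat) -uk.
have [w xw] : exists w : nat, x - x' = w%:Z.
  by exists `|x - x'|%N; rewrite gez0_abs // subr_ge0 -(ler_int rat) -ux -vx.
have [w' xw'] : exists w' : nat, w%:Z + k%:Z * (a - b) = w'%:Z.
  exists `|(w%:Z + k%:Z * (a - b))%R|%N; rewrite gez0_abs // -xw -(ler_int rat).
  move: vu'; rewrite uv ux vx uy yk !(intrD, intrN, intrM); lra.
have vE : v = u - w%:R *: f.
  apply: (coord_inj fr); rewrite !coordE ?uv ?vx ?ux; last by ring.
  by rewrite -[w%:R]/(w%:Z%:~R) -xw intrB; ring.
have auto (c : int) := shear_lattice_auto fr (intr_int rat c).
pose u2 := shear fr (a - b)%:~R u.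
have u2E : shear fr a%:~R u = shear fr b%:~R u2.
  by apply: (coord_inj fr); rewrite /u2 ?(cx_shear, cy_shear) // intrB; ring.
have pu2 : primitive (lattice e) u2 by exact: primitive_auto (auto _) pu.
have vE2 : v = u2 - w'%:R *: f.
  apply: (coord_inj fr); rewrite !coordE /u2 ?(cx_shear, cy_shear) ?uv; last by ring.
  rewrite vx ux uy yk -[w'%:R]/(w'%:Z%:~R) -xw' -xw !(intrD, intrN, intrM); ring.
have u2k : Y u2 = k%:R by rewrite /u2 cy_shear.
have u2x : X u2 = (x + k%:Z * (a - b))%:~R.
  by rewrite /u2 cx_shear ux uk !(intrD, intrN, intrM); ring.
rewrite u2E (residue_auto _ _ (auto b)) (nT_auto _ _ (auto b)) {1 3}vE2 vE.
rewrite !(nT_horizontal _ _ k0) //.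
rewrite (residue_horizontal _ u2x u2k k0 pu2) (residue_horizontal _ ux uk k0 pu).
have wdiv : (w'%:Z %/ k%:Z)%Z = (w%:Z %/ k%:Z)%Z + (a - b).
  by rewrite -xw' addrC mulrC divzMDl 1?addrC // -lt0n.
have wmod : (w' %% k = w %% k)%N.
  apply/eqP; rewrite -eqz_nat -!modz_nat -xw' addrC mulrC modzMDl.
  by [].
split; last by rewrite -!divz_nat.
have -> : w'%:Z - (x + k%:Z * (a - b)) = w%:Z - x by rewrite -xw'; ring.
by rewrite wmod.
Qed.

End HorizontalSteps.

(** * The mutation between its two sheared boundaries *)

Section MutationBounds.
Variables (V : vectType rat) (e : 2.-tuple V).
Variables (h : 'Hom(V, rat^o)) (P F : set V) (hmin hmax : int) (G : int -> set V).
Variables (f : V) (q : rat).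
Hypotheses (cP : convex P) (lo : forall x, P x -> hmin%:~R <= (h x : rat))
  (hi : forall x, P x -> (h x : rat) <= hmax%:~R)
  (adm : admissible e h P F hmin G) (Fq : F (q *: f))
  (Fle : forall y, F y -> exists2 c : rat, c <= q & y = c *: f).
Local Notation Q := (mutation_with e h P F hmin hmax G).

Let convex_level k : convex (level h k).
Proof.
move=> x y t xk yk _; rewrite /level /= linearD !linearZ /= xk yk.
change (t * k%:~R + (1 - t) * k%:~R = k%:~R :> rat); ring.
Qed.

Lemma slice_sub k : slice e h P k `<=` level h k `&` P.
Proof.
apply: conv_min => [x y t [xk Px] [yk Py] t01|x [[xk Px] _]] //.
by split; [exact: convex_level|exact: cP].
Qed.

(** Here q f is the end of F in the direction of f. At a height k >= 0 the
    mutation adds k F, which moves the end of a slice by k q f. At a height k < 0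
    a vertex r that is extremal in the direction f is g + |k| y with g in G k and
    y in F; since g + |k| q f is still in P, extremality forces y = q f, and g is
    r sheared by q. *)
Lemma mutation_mem r : vert P r -> lattice e r ->
  (forall t : rat, P (r + t *: f) -> t <= 0) -> (h r : rat) \is a Num.int ->
  Q (r + (q * (h r : rat)) *: f).
Proof.
move=> vr Lr rm /intrP[k hk]; have [Pr _] := vr.
have kmin : hmin <= k by rewrite -(ler_int rat) -hk lo.
have kmax : k <= hmax by rewrite -(ler_int rat) -hk hi.
apply: sub_conv; have [k0|k0] := leP 0 k.
  right; exists k => /=; first by rewrite k0.
  exists r; first by apply: sub_conv; split=> //; split.
  exists (k%:~R *: (q *: f)); first by exists (q *: f).
  by rewrite scalerA hk mulrC.
left; have k0' : hmin <= k < 0 by rewrite kmin.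
exists k => //; have [_ sub1 sub2] := adm k0'.
have [a Ga [_ [y Fy <-] ar]] : minkowski (G k) (dilate `|k|%:~R F) r by apply: sub1.
have [c cq yc] := Fle Fy.
have kk : (`|k|%:~R : rat) = - k%:~R by rewrite ltr0_norm // intrN.
have k0R : (k%:~R : rat) < 0 by rewrite ltrz0.
have : minkowski (G k) (dilate `|k|%:~R F) (a + `|k|%:~R *: (q *: f)).
  by exists a => //; exists (`|k|%:~R *: (q *: f)) => //; exists (q *: f).
move/sub2/slice_sub => [_].
have -> : a + `|k|%:~R *: (q *: f) = r + (`|k|%:~R * (q - c)) *: f.
  by rewrite -ar yc -addrA !scalerA -scalerDl; congr (_ + _ *: _); ring.
move=> /rm; rewrite kk => qc.
have -> : r + (q * (h r : rat)) *: f = a.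
  have -> : q = c by nra.
  by rewrite hk -ar yc kk scalerA -addrA -scalerDl mulNr [c * _]mulrC addNr scale0r addr0.
by [].
Qed.

(** With [mutation_mem], this makes the sheared boundary the boundary of Q in the
    direction of f. At a height k >= 0 a point c f of F, with c <= q, falls short
    of the end of F by q - c, whence t = k (q - c). At a height k < 0 the set
    G k + |k| q f lies in P, whence t = 0. *)
Lemma mutation_sub y : Q y ->
  exists z (t : rat), [/\ P z, 0 <= t & y = z + (q * (h z : rat)) *: f - t *: f].
Proof.
pose B := [set y | exists z (t : rat),
  [/\ P z, 0 <= t & y = z + (q * (h z : rat)) *: f - t *: f]].
apply: (@conv_min _ _ B _ _ y) => {y} [x y a [z [t [Pz t0 ->]]] [z' [t' [Pz' t0' ->]]] a01|y].
  exists (a *: z + (1 - a) *: z'), (a * t + (1 - a) * t'); split; first exact: cP.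
    by nra.
  have -> : (h (a *: z + (1 - a) *: z') : rat) = a * (h z : rat) + (1 - a) * (h z' : rat).
    by rewrite linearD !linearZ.
  rewrite -!addrA !scalerDr addrACA -!scaleNr -!scalerDl !scalerA -!scalerDl.
  by rewrite addrA; congr (_ + _ *: _); ring.
move=> [[k /= k0 Gy]|[k /= k0 [x xs [_ [u Fu <-] <-]]]].
  have [_ _ sub2] := adm k0.
  exists (y + `|k|%:~R *: (q *: f)), 0.
  have : minkowski (G k) (dilate `|k|%:~R F) (y + `|k|%:~R *: (q *: f)).
    by exists y => //; exists (`|k|%:~R *: (q *: f)) => //; exists (q *: f).
  move=> /sub2/slice_sub[hz Pz]; split=> //.
  have /andP[_ kn] := k0.
  rewrite hz ltr0_norm // intrN scale0r subr0 scalerA -addrA -scalerDl.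
  by rewrite mulNr [q * _]mulrC addNr scale0r addr0.
have [hx Px] := slice_sub xs; have [c cq ->] := Fle Fu.
have /andP[kge _] := k0; have kR : 0 <= (k%:~R : rat) by rewrite ler0z.
exists x, (k%:~R * (q - c)); split=> //; first by nra.
by rewrite hx scalerA -addrA -scaleNr -scalerDl; congr (_ + _ *: _); ring.
Qed.

End MutationBounds.

(** * The boundary of the mutation *)

Section MutationOfChains.
Variables (V : vectType rat) (e : 2.-tuple V).
Implicit Types (fr : frame e) (P Q : set V) (u v x y z r l : V) (R L : seq V).

Lemma shear_opp fr c : shear (opp_frame fr) c = shear fr c.
Proof.
by apply/lfunP => x; rewrite !shearE cy_opp /= mulrN scalerN scaleNr opprK.
Qed.

(** If Q contains the sheared chain and lies on its left, then the sheared chain is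
    the right chain of Q: moving left strictly decreases the form that supports an
    edge of a right chain, so only sheared points of that edge attain its
    maximum on Q. *)
Lemma chain_shear fr P Q (kmin kmax q : rat) r R : convex P -> P 0 -> convex Q -> Q 0 ->
    right_chain fr P kmin kmax r R ->
    (forall x, x \in r :: R -> Q (shear fr q x)) ->
    (forall y, Q y -> exists z (t : rat), [/\ P z, 0 <= t & y = shear fr q z - t *: axis fr]) ->
  right_chain fr Q kmin kmax (shear fr q r) (map (shear fr q) R).
Proof.
move=> cP P0 cQ Q0 [pR bR tR rR] inQ subQ; split.
- rewrite path_map.
  apply: (sub_in_path (P := mem (r :: R)) _ _ pR); last by apply/allP.
  move=> u v ur vr /andP[uv /asboolP /(ccw_edgeP fr u v cP P0)[D Pu Pv S]].
  rewrite /= /right_step !cy_shear uv /=; apply/asboolP/(ccw_edgeP fr) => //; split.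
  + move: D; rewrite !(detE fr) !cx_shear !cy_shear; lra.
  + exact: inQ.
  + exact: inQ.
  have sE z t : side fr (shear fr q u) (shear fr q v) (shear fr q z - t *: axis fr)
      = side fr u v z - t * (cy fr v - cy fr u).
    by rewrite /side !coordE !cx_shear !cy_shear; ring.
  have suE : side fr (shear fr q u) (shear fr q v) (shear fr q u) = side fr u v u.
    by have := sE u 0; rewrite mul0r scale0r !subr0.
  move=> y /subQ[z [t [Pz t0 ->]]]; have [sz cz] := S z Pz; rewrite sE suE; split; first by nra.
  move=> E; have tz : t = 0 by nra.
  have /cz/conv2P[a a01 zE] : side fr u v z = side fr u v u by move: E; rewrite tz; lra.
  apply/conv2P; exists a => //.
  by apply: (coord_inj fr); rewrite tz zE !(coordE, cx_shear, cy_shear); ring.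
- by rewrite cy_shear.
- by rewrite last_map cy_shear.
- move=> _ /(mapP (s := r :: R))[x xR ->]; split; first exact: inQ.
  move=> t /subQ[z [t' [Pz t0 E]]].
  have EY : cy fr z = cy fr x.
    by move: (congr1 (cy fr) E); rewrite !(coordE, cx_shear, cy_shear); lra.
  have := rightmost_abscissa (rR x xR) Pz EY.
  by move: (congr1 (cx fr) E); rewrite !(coordE, cx_shear, cy_shear) EY; lra.
Qed.

Lemma lattice_origin : lattice e 0.
Proof. by move=> i; rewrite linear0. Qed.

(** The left chain is sheared by p, the coordinate of the other end of F: it is
    treated with the axis reversed, where that end has coordinate - p. *)
Lemma mutation_chains fr P F (hmin hmax : int) (G : int -> set V) (p q : int) r R l L :
    (forall x, vert P x -> lattice e x) ->
    admissible e (height fr) P F hmin G ->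
    F (p%:~R *: axis fr) -> F (q%:~R *: axis fr) ->
    (forall y, F y -> exists2 c : rat, p%:~R <= c <= q%:~R & y = c *: axis fr) ->
    polygon_chains fr P hmin%:~R hmax%:~R r R l L ->
  polygon_chains fr (mutation_with e (height fr) P F hmin hmax G) hmin%:~R hmax%:~R
    (shear fr q%:~R r) (map (shear fr q%:~R) R)
    (shear fr p%:~R l) (map (shear fr p%:~R) L).
Proof.
move=> latP adm Fp Fq Fpq poly; have [cP P0 kmin0 kmax0 hP rc lc] := poly.
set Q := mutation_with _ _ _ _ _ _ _.
have cQ : convex Q by exact: conv_convex.
have lo x : P x -> hmin%:~R <= (height fr x : rat) by move=> /hP/andP[].
have hi x : P x -> (height fr x : rat) <= hmax%:~R by move=> /hP/andP[].
have Q0 : Q 0.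
  apply: sub_conv; right; exists 0 => /=; first by rewrite -(ler0z rat) ltW.
  exists 0; last first.
    by exists (0%:~R *: (p%:~R *: axis fr)); [exists (p%:~R *: axis fr)|rewrite scale0r addr0].
  by apply: sub_conv; split; [split=> //=; rewrite /level /= linear0|exact: lattice_origin].
have Fle y : F y -> exists2 c : rat, c <= q%:~R & y = c *: axis fr.
  by move=> /Fpq[c /andP[]]; exists c.
have Fge y : F y -> exists2 c : rat, c <= - p%:~R & y = c *: - axis fr.
  by move=> /Fpq[c /andP[pc cq] ->]; exists (- c); rewrite ?lerN2 // scalerN scaleNr opprK.
have Fp' : F (- p%:~R *: - axis fr) by rewrite scalerN scaleNr opprK.
have chain_vert x : (x \in r :: R) || (x \in l :: L) -> vert P x by move=> /(vert_chains poly x).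
have hint x : lattice e x -> (height fr x : rat) \is a Num.int by move=> /(lattice_frame fr)[].
have subQ y : Q y -> exists z (t : rat), [/\ P z, 0 <= t & y = shear fr q%:~R z - t *: axis fr].
  move=> /(mutation_sub cP adm Fq Fle)[z [t [Pz t0 ->]]].
  by exists z, t; rewrite shearE.
have subQ' y : Q y -> exists z (t : rat), [/\ P z, 0 <= t &
    y = shear (opp_frame fr) p%:~R z - t *: axis (opp_frame fr)].
  move=> /(mutation_sub cP adm Fp' Fge)[z [t [Pz t0 ->]]].
  by exists z, t; rewrite shear_opp shearE mulNr scalerN scaleNr opprK.
split=> //.
- by move=> y /subQ[z [t [Pz t0 ->]]]; rewrite !(coordE, cy_shear) mulr0 subr0 hP.
- apply: (chain_shear cP P0 cQ Q0 rc) subQ => x xR.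
  have vx : vert P x by apply: chain_vert; rewrite xR.
  rewrite shearE; apply: (mutation_mem cP lo hi adm Fq Fle vx).
  + exact: latP.
  + by case: rc => _ _ _ /(_ x xR)[].
  + exact: hint (latP _ vx).
- have := chain_shear cP P0 cQ Q0 lc _ subQ'; rewrite shear_opp; apply=> x xL.
  have vx : vert P x by apply: chain_vert; rewrite xL orbT.
  rewrite shearE (_ : _ *: axis fr = (- p%:~R * (height fr x : rat)) *: - axis fr).
    apply: (mutation_mem cP lo hi adm Fp' Fge vx).
    + exact: latP.
    + by case: lc => _ _ _ /(_ x xL)[].
    + exact: hint (latP _ vx).
  by rewrite mulNr scaleNr scalerN opprK.
Qed.

Lemma edge_content_auto a b E : lattice_auto e a b ->
  edge_content e [seq (a s.1, a s.2) | s <- E] = edge_content e E.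
Proof.
move=> ab; rewrite /edge_content big_map; congr (_, _).
  by apply: eq_bigr => s _; rewrite (nT_auto _ _ ab).
by elim: E => //= s E ->; rewrite (residue_auto _ _ ab).
Qed.

Lemma edge_content_cat E E' : edge_content e (E ++ E') =
  (((edge_content e E).1 + (edge_content e E').1)%N,
   (edge_content e E).2 ++ (edge_content e E').2).
Proof. by rewrite /edge_content big_cat pmap_cat. Qed.

Lemma pairmap_pair_map (a : V -> V) x R :
  pairmap pair (a x) (map a R) = [seq (a s.1, a s.2) | s <- pairmap pair x R].
Proof. by elim: R x => //= y R IHR x; rewrite IHR. Qed.

(** At the top, n grows by the lattice length a - b of F. In the opposite frame,
    where a and b are exchanged, the same lemma says that n decreases by that
    length at the bottom. *)
Lemma top_step fr P Q kmin kmax r R l L (a b : int) :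
    (forall x, vert P x -> primitive (lattice e) x) ->
    polygon_chains fr P kmin kmax r R l L ->
    polygon_chains fr Q kmin kmax (shear fr a%:~R r) (map (shear fr a%:~R) R)
      (shear fr b%:~R l) (map (shear fr b%:~R) L) ->
  residue e (shear fr a%:~R (last r R)) (shear fr b%:~R l) = residue e (last r R) l /\
  (nT e (shear fr a%:~R (last r R)) (shear fr b%:~R l))%:Z
    = (nT e (last r R) l)%:Z + (a - b).
Proof.
move=> prim polyP polyQ.
have [_ _ _ kmax0 _ [_ _ tR rR] [_ bL _ rL]] := polyP.
have [_ _ _ _ _ [_ _ tR' rR'] [_ bL' _ rL']] := polyQ.
rewrite last_map in tR' rR'; rewrite cy_opp in bL bL'.
have bL2 : cy fr l = kmax by apply: oppr_inj.
have primR x : x \in r :: R -> primitive (lattice e) x.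
  by move=> xR; apply: prim; apply/(vert_chains polyP); rewrite xR.
have primL x : x \in l :: L -> primitive (lattice e) x.
  by move=> xL; apply: prim; apply/(vert_chains polyP); rewrite xL orbT.
apply: horizontal_step.
- by apply: primR; exact: mem_last.
- by case: (primL l (mem_head _ _)).
- by rewrite tR.
- by rewrite tR bL2.
- apply: (rightmost_abscissa (P := P)); last by rewrite tR bL2.
    by apply: rR; exact: mem_last.
  by case: (rL l (mem_head _ _)).
- apply: (rightmost_abscissa (P := Q)); last by rewrite !cy_shear tR bL2.
    by apply: rR'; rewrite -(last_map (shear fr a%:~R)); exact: mem_last.
  by case: (rL' _ (mem_head _ _)).
Qed.

Lemma singularity_content_mutation fr P Q kmin kmax r R l L (a b : int) :
    (forall x, vert P x -> primitive (lattice e) x) ->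
    polygon_chains fr P kmin kmax r R l L ->
    polygon_chains fr Q kmin kmax (shear fr a%:~R r) (map (shear fr a%:~R) R)
      (shear fr b%:~R l) (map (shear fr b%:~R) L) ->
  singularity_content e P = singularity_content e Q.
Proof.
move=> prim polyP polyQ.
rewrite (singularity_content_chains polyP) (singularity_content_chains polyQ).
have [resT nTT] := top_step prim polyP polyQ.
have polyQ' := polygon_chains_opp polyQ; rewrite -!(shear_opp fr) in polyQ'.
have [] := top_step prim (polygon_chains_opp polyP) polyQ'; rewrite !shear_opp => resB nTB.
suff -> : edge_content e (pairmap pair r (closed_walk r R l L)) =
    edge_content e (pairmap pair (shear fr a%:~R r) (closed_walk (shear fr a%:~R r)
      (map (shear fr a%:~R) R) (shear fr b%:~R l) (map (shear fr b%:~R) L))) by [].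
have split_walk r' R' l' L' : pairmap pair r' (closed_walk r' R' l' L') =
   pairmap pair r' R' ++ [:: (last r' R', l')] ++ pairmap pair l' L' ++ [:: (last l' L', r')].
  by rewrite /closed_walk pairmap_cat /= -cats1 pairmap_cat.
rewrite !split_walk !pairmap_pair_map !last_map !edge_content_cat.
have auto (c : int) := shear_lattice_auto fr (intr_int rat c).
rewrite !(edge_content_auto _ (auto _)) /= !big_seq1 /= resT resB; congr (_, _).
by lia.
Qed.

End MutationOfChains.

(** * Fano polygons and their mutations *)

Section FanoPolygons.
Variables (V : vectType rat) (e : 2.-tuple V).
Implicit Types (fr : frame e) (P F : set V).

Lemma interior_absorbing P v : strict_interior e P 0 ->
  exists2 c : rat, 0 < c & P (c *: v).
Proof.
move=> [d d0 Pd]; pose n := 1 + \sum_i `|coord e i v|.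
have le_n i : `|coord e i v| < n.
  rewrite /n (bigD1 i) //= addrCA ltrDl.
  by rewrite ltr_pwDl // sumr_ge0.
have n0 : 0 < n by apply: le_lt_trans (le_n 0).
exists (d / n); first by rewrite divr_gt0.
apply: Pd => i; rewrite subr0 linearZ /=.
change (`|d / n * coord e i v| < d).
rewrite normrM gtr0_norm ?divr_gt0 // mulrAC ltr_pdivrMr // ltr_pM2l //.
Qed.

Lemma polygon_chains_exist fr P (hmin hmax : int) :
    lattice_polytope e P -> strict_interior e P 0 ->
    is_min (height fr) P hmin -> is_max (height fr) P hmax ->
  exists r R l L, polygon_chains fr P hmin%:~R hmax%:~R r R l L.
Proof.
move=> [s _ Ps] int0 [attmin lo] [attmax hi].
have cP : convex P by rewrite Ps; exact: conv_convex.
have absorb v := interior_absorbing v int0.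
have P0 : P 0 by have [c _] := absorb 0; rewrite scaler0.
have kmin0 : (hmin%:~R : rat) < 0.
  have [c c0 Pc] := absorb (- coaxis fr); have := lo _ Pc.
  rewrite -[height fr _]/(cy fr _) !coordE [cy fr (coaxis fr)]height_coaxis; lra.
have kmax0 : 0 < (hmax%:~R : rat).
  have [c c0 Pc] := absorb (coaxis fr); have := hi _ Pc.
  rewrite -[height fr _]/(cy fr _) !coordE [cy fr (coaxis fr)]height_coaxis; lra.
have [c c0 Pc] := absorb (axis fr).
have [r [R rc]] := right_chain_exists Ps P0 c0 Pc attmin lo attmax hi.
have [c' c0' Pc'] := absorb (axis (opp_frame fr)).
have [||||l [L lc]] := right_chain_exists (fr := opp_frame fr) (kmin := - hmax%:~R)
  (kmax := - hmin%:~R) Ps P0 c0' Pc'.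
- by have [x Px xk] := attmax; exists x => //; rewrite cy_opp; congr (- _).
- by move=> x /hi; rewrite cy_opp lerN2.
- by have [x Px xk] := attmin; exists x => //; rewrite cy_opp; congr (- _).
- by move=> x /lo; rewrite cy_opp lerN2.
exists r, R, l, L; split=> // x Px; apply/andP; split; [exact: lo|exact: hi].
Qed.

Lemma factor_segment fr F : is_factor e (height fr) F ->
  exists p q : int, [/\ F (p%:~R *: axis fr), F (q%:~R *: axis fr)
    & forall y, F y -> exists2 c : rat, p%:~R <= c <= q%:~R & y = c *: axis fr].
Proof.
move=> [[s sL Fs] F0 Fh].
have s0 : s != [::].
  by apply/eqP => s0; case: F0 => y; rewrite Fs s0 set_nil conv_set0.
have on_axis y : F y -> y = cx fr y *: axis fr.
  move=> /Fh yh; apply: (coord_inj fr); rewrite !coordE ?mulr1 // mulr0.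
  by rewrite /cy yh.
have end_int v : vert (conv [set` s]) v -> exists2 c : int, F v & v = c%:~R *: axis fr.
  move=> vv; have Fv : F v by rewrite Fs; case: vv.
  have /sL/(lattice_frame fr)[/intrP[c cE] _] := conv_vert vv.
  by exists c => //; rewrite {1}(on_axis v Fv) /cx cE.
have inj x y : cx fr x = cx fr y -> cy fr x = cy fr y -> x = y by exact: coord_inj.
have [v vv vmax] := lex_vertex (@abscissa_affine _ _ fr) (@height_affine _ _ fr) inj s0.
have [q Fv vE] := end_int v vv.
have [||u uu umin] := lex_vertex (m := fun x => - cx fr x) _ (@height_affine _ _ fr) _ s0.
- by move=> x y t; rewrite !coordE; ring.
- by move=> x y /oppr_inj; exact: inj.
have [p Fu uE] := end_int u uu.
exists p, q; rewrite -uE -vE; split=> // y Fy; exists (cx fr y); last exact: on_axis.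
have vX : cx fr v = q%:~R by rewrite vE !coordE mulr1.
have uX : cx fr u = p%:~R by rewrite uE !coordE mulr1.
rewrite -uX -vX -Fs in vmax umin *.
by case: (vmax y Fy) => [|[]]; case: (umin y Fy) => [|[]]; lra.
Qed.

Lemma singularity_content_is_mutation (P F Q : set V) (h : 'Hom(V, rat^o)) :
    basis_of fullv e -> fano_polygon e P -> primitive (dual_lattice e) h ->
    is_factor e h F -> is_mutation e h P F Q ->
  singularity_content e P = singularity_content e Q.
Proof.
move=> he [latP int0 prim] /(frame_of_height he)[fr <-] facF [hmin [hmax [minP maxP [G adm ->]]]].
have [r [R [l [L poly]]]] := polygon_chains_exist latP int0 minP maxP.
have [p [q [Fp Fq Fpq]]] := factor_segment facF.
apply: (singularity_content_mutation prim poly).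
by apply: (mutation_chains _ adm Fp Fq Fpq poly) => x /prim[].
Qed.

End FanoPolygons.

Theorem proposition3p6 (V : vectType rat) (e : 2.-tuple V)
    (he : basis_of fullv e) :
  (forall (P F Q : set V) (h : 'Hom(V, rat^o)),
     fano_polygon e P -> primitive (dual_lattice e) h -> is_factor e h F ->
     is_mutation e h P F Q ->
     singularity_content e P = singularity_content e Q) /\
  (forall P Q : set V, mutation_equivalent e P Q ->
     singularity_content e P = singularity_content e Q).
Proof.
have inv P F Q h := @singularity_content_is_mutation V e P F Q h he.
split=> [P F Q h|P Q]; first exact: inv.
elim=> {P Q} [P Q [fanoP [h [F [ph facF mutQ]]]]|//|P Q _ -> //|P Q S _ -> _ ->//].
exact: inv fanoP ph facF mutQ.
Qed.
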